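(* Let $A$ and $B$ be non-trivial recursively presented groups, where $A$ has an infinite number of conjugacy classes and $B$ acts on a set $S$ transitively, so $S=B/H$ where $H$ is the stabiliser of some arbitrary point $s_0\in S$. The conjugacy problem in the permutational restricted wreath product $A\wr_S B$ is solvable if and only if: (i) the conjugacy problem is solvable in $A$ and in $B$; (ii) either $A$ is abelian or the orbit order problem is solvable in $B$; (iii) the membership problem for $H\gamma\langle\beta\rangle$ (for any $\gamma,\beta\in B$) is solvable; and (iv) for any $\beta\in B$ and any finite set of $n$ pairs of elements $(\alpha_i,\gamma_i)$, where $\alpha_i,\gamma_i\in B$ and $1\le i\le n$, one can determine whether or not $\big[\bigcap_{i=1}^n \alpha_i^{-1}H\gamma_i\langle\beta\rangle\big]\cap C_B(\beta)=\emptyset$.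
   Context: A group is recursively presented if it has a presentation with finitely many generators and a recursively enumerable set of relators. Elements are given as words in the generators. The conjugacy problem is solvable if an algorithm decides, for any two words in the generators, whether they represent conjugate elements. $C_B(\beta)$ is the centraliser of $\beta$ in $B$. $B$ acts on $S$ on the right, and $S$ is identified with the set $B/H$ of right cosets $Ht$ ($t\in B$) via $s_0t\leftrightarrow Ht$. For $b\in B$, a $b$-orbit is an orbit of $\langle b\rangle$ on $S$. Permutational restricted wreath product: $A\wr_S B=\{(b,f): b\in B,\ f\in A^{(S)}\}$, where $A^{(S)}$ is the group (pointwise multiplication) of functions $f:S\to A$ with finite support $\sigma(f)=\{s: f(s)\ne 1_A\}$, $f^{c}(s)=f(sc^{-1})$, and $(b,f)(c,g)=(bc,f^{c}g)$. It is generated by the elements $(b,1)$ with $b$ a generator of $B$ and $(1_B,a^{(s_0)})$ with $a$ a generator of $A$, where $a^{(s)}$ takes the value $a$ at $s$ and $1_A$ elsewhere. Orbit order problem: decide, for any $b\in B$ and any $b$-orbit in $S$ (given by a representative $s_0t$, $t\in B$), whether that $b$-orbit is finite (equivalently, decide for any $b\in B$ whether $H\langle b\rangle$ contains finitely or infinitely many right $H$-cosets). Membership problem for $H\gamma\langle\beta\rangle$: there is an algorithm which, given words for $\gamma,\beta,w\in B$, decides whether $w\in H\gamma\langle\beta\rangle$. In (iv), ''can determine'' means there is an algorithm taking $\beta$ and the pairs $(\alpha_i,\gamma_i)$ as input. *)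

(* Defs.v *)
From HB Require Import structures.
From mathcomp Require Import all_boot finmap.
From mathcomp Require Import boolp classical_sets cardinality.

Set Implicit Arguments.
Unset Strict Implicit.
Unset Printing Implicit Defensive.

Local Open Scope fset_scope.
Local Open Scope classical_set_scope.
Local Open Scope group_scope.

(** Total recursive functions in Kleene's sense. Minimisation is restricted to
    regular functions, so that every function generated is total; the functions
    obtained are exactly the total computable functions [nat ^ n -> nat]. *)
Inductive recursive : forall n : nat, (n.-tuple nat -> nat) -> Prop :=
| recursive_zero n : @recursive n (fun=> 0)
| recursive_succ : @recursive 1 (fun v => (thead v).+1)
| recursive_proj n (i : 'I_n) : @recursive n (fun v => tnth v i)
| recursive_comp m n (f : m.-tuple nat -> nat)
    (g : 'I_m -> n.-tuple nat -> nat) :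
    recursive f -> (forall i, recursive (g i)) ->
    @recursive n (fun v => f [tuple g i v | i < m])
| recursive_prim n (f : n.-tuple nat -> nat) (g : n.+2.-tuple nat -> nat)
    (h : n.+1.-tuple nat -> nat) :
    recursive f -> recursive g ->
    (forall v : n.-tuple nat, h [tuple of 0 :: v] = f v) ->
    (forall k (v : n.-tuple nat), h [tuple of k.+1 :: v] =
       g [tuple of k :: h [tuple of k :: v] :: v]) ->
    recursive h
| recursive_min n (f : n.+1.-tuple nat -> nat) (h : n.-tuple nat -> nat) :
    recursive f ->
    (forall v : n.-tuple nat, f [tuple of h v :: v] = 0) ->
    (forall (v : n.-tuple nat) k, k < h v -> f [tuple of k :: v] != 0) ->
    recursive h.

(** Finite data (words, pairs and lists of words, ...) are coded by natural
    numbers through [pickle], which on these types is the usual effective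
    numbering. (The name is qualified because [finmap] shadows it.) *)
Definition computable (T U : countType) (f : T -> U) : Prop :=
  exists2 F : 1.-tuple nat -> nat,
    recursive F & forall x, F [tuple choice.pickle x] = choice.pickle (f x).

Definition algorithmic (T : countType) (P : set T) : Prop :=
  exists2 d : T -> bool, computable d & forall x, P x <-> d x.

(** The value [None] is "no output at this stage"; it allows [P] to be empty. *)
Definition recursively_enumerable (T : countType) (P : set T) : Prop :=
  exists2 e : nat -> option T,
    computable e & forall x, P x <-> exists k, e k = Some x.

(** The letter [(i, false)] is the generator [i], and [(i, true)] is its formal
    inverse. *)
Definition word (I : countType) : countType := seq (I * bool).

Definition word_eval (I : countType) (G : groupType) (g : I -> G)
    (w : word I) : G :=
  \prod_(l <- w) (if l.2 then (g l.1)^-1 else g l.1).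

(** The words representing the identity of the group presented by the relators
    [R]: those obtained from the empty word by inserting and deleting relators
    and pairs of mutually inverse letters. *)
Inductive consequence (I : countType) (R : set (word I)) : word I -> Prop :=
| consequence_nil : consequence R [::]
| consequence_ins_rel u r v :
    R r -> consequence R (u ++ v) -> consequence R (u ++ r ++ v)
| consequence_del_rel u r v :
    R r -> consequence R (u ++ r ++ v) -> consequence R (u ++ v)
| consequence_ins_inv u i e v :
    consequence R (u ++ v) ->
    consequence R (u ++ [:: (i, e); (i, ~~ e)] ++ v)
| consequence_del_inv u i e v :
    consequence R (u ++ [:: (i, e); (i, ~~ e)] ++ v) ->
    consequence R (u ++ v).

Definition presentation (I : countType) (G : groupType) (g : I -> G)
    (R : set (word I)) : Prop :=
  (forall x : G, exists w, word_eval g w = x) /\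
  (forall w, word_eval g w = 1 <-> consequence R w).

Definition recursively_presented (p : nat) (G : groupType) (g : 'I_p -> G) :
    Prop :=
  exists2 R : set (word 'I_p), recursively_enumerable R & presentation g R.

Definition nontrivial (G : groupType) : Prop := exists x : G, x != 1.

Definition abelian_group (G : groupType) : Prop := forall x y : G, commute x y.

Definition conjugacy_class (G : groupType) (a : G) : set G :=
  [set a ^ x | x in [set: G]].

Definition conjugacy_classes (G : groupType) : set (set G) :=
  [set conjugacy_class a | a in [set: G]].

Arguments conjugacy_classes G : clear implicits.

Definition cyclic_subgroup (G : groupType) (b : G) : set G :=
  [set c | exists k : nat, c = b ^+ k \/ c = b ^- k].

Definition centraliser (G : groupType) (b : G) : set G :=
  [set c | commute c b].

Definition conjugacy_problem (I : countType) (G : groupType) (g : I -> G) :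
    Prop :=
  algorithmic (fun uv : word I * word I =>
    exists x : G, word_eval g uv.1 ^ x = word_eval g uv.2).

Record right_action (B : groupType) (S : Type) := RightAction {
  ract :> S -> B -> S;
  ract1 : forall s, ract s 1 = s;
  ractM : forall s b c, ract s (b * c) = ract (ract s b) c
}.

Definition transitive_action (B : groupType) (S : Type)
    (to : right_action B S) : Prop :=
  forall s t : S, exists b : B, to s b = t.

Definition stabiliser (B : groupType) (S : Type) (to : right_action B S)
    (s : S) : set B :=
  [set b | to s b = s].

Definition cyclic_orbit (B : groupType) (S : Type) (to : right_action B S)
    (b : B) (s : S) : set S :=
  [set to s c | c in cyclic_subgroup b].

(** The carrier does not depend on the action [to], but the product does; the
    argument is there to determine the group structure. *)
Definition wreath (A B : groupType) (S : choiceType) (to : right_action B S) :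
    Type :=
  B * {fsfun S -> A with 1}.

Section Wreath.

Context {A B : groupType} {S : choiceType} (to : right_action B S).

Local Notation wreath := (wreath A to).
Local Notation base := {fsfun S -> A with 1}.

Definition base_mul (f g : base) : base :=
  [fsfun s in (finsupp f `|` finsupp g)%fset => f s * g s | 1].

Definition base_inv (f : base) : base :=
  [fsfun s in finsupp f => (f s)^-1 | 1].

Definition base_act (f : base) (c : B) : base :=
  [fsfun s in [fset to s c | s in finsupp f]%fset => f (to s c^-1) | 1].

Definition base_delta (a : A) (s : S) : base :=
  [fsfun x in [fset s]%fset => a | 1].

Lemma base_mulE f g s : base_mul f g s = f s * g s.
Proof.
rewrite fsfunE in_fsetU; case: ifPn => //; rewrite negb_or => /andP[fs gs].
by rewrite !fsfun_dflt // mulg1.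
Qed.

Lemma base_invE f s : base_inv f s = (f s)^-1.
Proof. by rewrite fsfunE; case: finsuppP => // _; rewrite invg1. Qed.

Lemma base_actE f c s : base_act f c s = f (to s c^-1).
Proof.
rewrite fsfunE; case: ifPn => // /negP sN; rewrite fsfun_dflt //.
apply/negP => sf; apply: sN; apply/imfsetP; exists (to s c^-1) => //.
by rewrite -ractM mulVg ract1.
Qed.

Lemma base_deltaE a s x : base_delta a s x = if x == s then a else 1.
Proof. by rewrite fsfunE in_fset1. Qed.

HB.instance Definition _ := Choice.on wreath.

Definition wreath_one : wreath := (1, [fsfun of _ => 1]).

Definition wreath_mul (x y : wreath) : wreath :=
  (x.1 * y.1, base_mul (base_act x.2 y.1) y.2).

Definition wreath_inv (x : wreath) : wreath :=
  (x.1^-1, base_inv (base_act x.2 x.1^-1)).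

Fact wreath_mulA : associative wreath_mul.
Proof.
move=> [b f] [c g] [d h]; congr pair; first exact: mulgA.
apply/fsfunP => s; rewrite !(base_mulE, base_actE) /= mulgA.
by rewrite invgM ractM.
Qed.

Fact wreath_mul1 : left_id wreath_one wreath_mul.
Proof.
move=> [b f]; congr pair; first exact: mul1g.
by apply/fsfunP => s; rewrite base_mulE base_actE fsfunE mul1g.
Qed.

Fact wreath_mulr1 : right_id wreath_one wreath_mul.
Proof.
move=> [b f]; congr pair; first exact: mulg1.
by apply/fsfunP => s; rewrite base_mulE base_actE fsfunE invg1 ract1 mulg1.
Qed.

Fact wreath_mulV : left_inverse wreath_one wreath_inv wreath_mul.
Proof.
move=> [b f]; congr pair; first exact: mulVg.
apply/fsfunP => s.
by rewrite !(base_mulE, base_actE, base_invE) /= invgK -ractM mulVg ract1 mulVg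
  fsfunE.
Qed.

Fact wreath_mulrV : right_inverse wreath_one wreath_inv wreath_mul.
Proof.
move=> [b f]; congr pair; first exact: mulgV.
apply/fsfunP => s.
by rewrite !(base_mulE, base_actE, base_invE) /= mulgV fsfunE.
Qed.

HB.instance Definition _ := isGroup.Build wreath
  wreath_mulA wreath_mul1 wreath_mulr1 wreath_mulV wreath_mulrV.

Definition wreath_gens (p q : nat) (gA : 'I_p -> A) (gB : 'I_q -> B) (s0 : S) :
    'I_q + 'I_p -> wreath :=
  fun i => match i with
           | inl j => (gB j, [fsfun of _ => 1])
           | inr j => (1, base_delta (gA j) s0)
           end.

End Wreath.

Section Problems.

Context {B : groupType} {S : Type} (to : right_action B S) (s0 : S).

Local Notation H := (stabiliser to s0).

Definition stab_cyclic (gamma beta : B) : set B :=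
  [set h * gamma * c | h in H & c in cyclic_subgroup beta].

Context {q : nat} (gB : 'I_q -> B).

Local Notation ev := (word_eval gB).

Definition orbit_order_problem : Prop :=
  algorithmic (fun x : word 'I_q * word 'I_q => let: (b, t) := x in
    finite_set (cyclic_orbit to (ev b) (to s0 (ev t)))).

Definition membership_problem : Prop :=
  algorithmic (fun x : word 'I_q * word 'I_q * word 'I_q =>
    let: (gamma, beta, w) := x in stab_cyclic (ev gamma) (ev beta) (ev w)).

(** A pair in the list consists of words for $\alpha_i$ and $\gamma_i$. *)
Definition intersection_problem : Prop :=
  algorithmic (fun x : word 'I_q * seq (word 'I_q * word 'I_q) =>
    let: (beta, ps) := x in
    (\bigcap_(p in [set` ps])
       [set (ev p.1)^-1 * x | x in stab_cyclic (ev p.2) (ev beta)])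
    `&` centraliser (ev beta) = set0).

End Problems.

(* Main.v *)
(** In [A wr_S B], [(b, f)] and [(b', f')] are conjugate iff for some [c] with
    [b c = c b'] the functions [f^c] and [f'] are related by
    [f' s = (g (s b'^-1))^-1 * f^c s * g s] for a finitely supported [g]. Such a
    [g] can push the value at [s] onto [s b'], so every function can be
    concentrated on at most one point of each [b']-orbit. Telescoping the
    relation along an orbit shows that the remaining value is then determined
    exactly if the orbit is infinite, and up to conjugacy if it is finite.
    Conjugacy of two elements thus amounts to the existence of [c] in [C_B(b)]
    matching finitely many orbits in a prescribed way, which is what (i)-(iv)
    decide; the conjugations to concentrated form are found by unbounded search.

    Conversely, each of (ii)-(iv) is tested by a pair of elements over the same
    [b]: the values [a], [a^-1] placed at two points can be cancelled iff the
    points lie in one orbit; distinct conjugate values [a], [a'] placed at the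
    same point give conjugate elements iff its orbit is finite; and pairwise
    non-conjugate values, of which there is an unlimited supply, force [c] to
    carry the orbit of [s0 alpha_i] to that of [s0 gamma_i]. *)
Require Import Defs.
From HB Require Import structures.
From mathcomp Require Import all_boot finmap.
From mathcomp Require Import boolp classical_sets cardinality.

Set Implicit Arguments.
Unset Strict Implicit.
Unset Printing Implicit Defensive.

(** * Recursive functions *)

Local Notation pickle := choice.pickle.

Section Recursive.

Lemma eq_recursive n (f g : n.-tuple nat -> nat) :
  f =1 g -> recursive f -> recursive g.
Proof. by move=> /funext ->. Qed.

Definition recursive1 (f : nat -> nat) : Prop :=
  @recursive 1 (fun v => f (thead v)).

Definition recursive2 (f : nat -> nat -> nat) : Prop :=
  @recursive 2 (fun v => f (tnth v ord0) (tnth v ord_max)).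

Lemma recursive_app1 n (f : nat -> nat) (g : n.-tuple nat -> nat) :
  recursive1 f -> recursive g -> recursive (fun v => f (g v)).
Proof.
move=> rf rg; apply: eq_recursive (recursive_comp rf (fun _ : 'I_1 => rg)) => v.
by rewrite /thead tnth_mktuple.
Qed.

Lemma recursive_app2 n (f : nat -> nat -> nat) (g h : n.-tuple nat -> nat) :
  recursive2 f -> recursive g -> recursive h ->
  recursive (fun v => f (g v) (h v)).
Proof.
move=> rf rg rh.
have rgh i : recursive ((fun i : 'I_2 => if i == ord0 then g else h) i).
  by case: eqP.
by apply: eq_recursive (recursive_comp rf rgh) => v; rewrite !tnth_mktuple.
Qed.

Lemma recursive_const n c : @recursive n (fun=> c).
Proof.
elim: c => [|c IH]; first exact: recursive_zero.
exact: recursive_app1 recursive_succ IH.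
Qed.

Lemma recursive1_id : recursive1 id.
Proof. exact: recursive_proj. Qed.

Lemma recursive1_comp f g :
  recursive1 f -> recursive1 g -> recursive1 (fun x => f (g x)).
Proof. exact: recursive_app1. Qed.

Lemma recursive_iter f : recursive1 f -> recursive2 (fun k x => iter k f x).
Proof.
move=> rf; apply: (@recursive_prim 1 (@thead 0 nat)
  (fun v => f (tnth v (inord 1)))).
- exact: recursive_proj.
- by apply: recursive_app1 => //; exact: recursive_proj.
- by move=> v; rewrite /thead !(tnth_nth 0).
- by move=> k v; rewrite !(tnth_nth 0) !inordK.
Qed.

Lemma recursive1_prim c (g : nat -> nat -> nat) h :
  recursive2 g -> h 0 = c -> (forall k, h k.+1 = g k (h k)) -> recursive1 h.
Proof.
move=> rg h0 hS; apply: (@recursive_prim 0 (fun=> c) _ _ _ rg).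
- exact: recursive_const.
- by move=> v; rewrite theadE.
- by move=> k v; rewrite !(tnth_nth 0) theadE hS.
Qed.

Lemma recursive2_fst : recursive2 (fun x _ => x).
Proof. exact: recursive_proj. Qed.

Lemma recursive2_snd : recursive2 (fun _ y => y).
Proof. exact: recursive_proj. Qed.

Lemma recursive1_pred : recursive1 predn.
Proof. exact: (recursive1_prim recursive2_fst (erefl 0)). Qed.

Lemma recursive2_sub : recursive2 subn.
Proof.
apply: eq_recursive (_ : recursive (fun v : 2.-tuple nat =>
  iter (tnth v ord_max) predn (tnth v ord0))).
  move=> v; move: (tnth v ord0) (tnth v ord_max) => m n.
  by elim: n => [|n IH] /=; rewrite ?subn0 // IH -subnS.
apply: (recursive_app2 (recursive_iter recursive1_pred)).
  exact: recursive_proj.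
exact: recursive_proj.
Qed.

Lemma recursive2_add : recursive2 addn.
Proof.
apply: eq_recursive (_ : recursive (fun v : 2.-tuple nat =>
  iter (tnth v ord0) S (tnth v ord_max))) => [v|];
    first by rewrite iter_succn addnC.
apply: (recursive_app2 (recursive_iter recursive_succ)).
  exact: recursive_proj.
exact: recursive_proj.
Qed.

Lemma recursive1_double : recursive1 double.
Proof.
apply: eq_recursive (recursive_app2 recursive2_add recursive1_id recursive1_id).
by move=> v; rewrite addnn.
Qed.

Lemma recursive1_odd : recursive1 (fun n => odd n : nat).
Proof.
apply: (@recursive1_prim 0 (fun _ b => 1 - b)) => //.
  exact: recursive_app2 recursive2_sub (recursive_const _ 1) recursive2_snd.
by move=> k /=; case: odd.
Qed.

Lemma recursive1_half : recursive1 half.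
Proof.
(* The recursion is [half k.+1 = k - half k]. *)
apply: (@recursive1_prim 0 subn) => //; first exact: recursive2_sub.
move=> k; rewrite -[k.+1./2]/(uphalf k) uphalf_half.
by rewrite -[X in _ = X - _]odd_double_half -addnn addnA addnK.
Qed.

(** One step of [CodeSeq.code]: the empty list has code 0, and prepending [x] to the list coded by
    [c] gives this number. Thus [x] is the 2-adic valuation of a nonzero code; pairs are coded as
    two-element lists. *)
Definition code_cons x c := 2 ^ x * c.*2.+1.

Lemma recursive2_code_cons : recursive2 code_cons.
Proof.
apply: eq_recursive (_ : recursive (fun v : 2.-tuple nat =>
  iter (tnth v ord0) double (tnth v ord_max).*2.+1)).
  move=> v; move: (tnth v ord0) (tnth v ord_max) => m n; rewrite /code_cons.
  elim: m => [|m IH] /=; first by rewrite mul1n.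
  by rewrite IH expnS -mulnA mul2n.
apply: (recursive_app2 (recursive_iter recursive1_double)).
  exact: recursive_proj.
apply: recursive_app1 recursive_succ _.
apply: recursive_app1 recursive1_double _; exact: recursive_proj.
Qed.

Definition code_head c := head 0 (CodeSeq.decode c).
Definition code_tail c := CodeSeq.code (behead (CodeSeq.decode c)).

Lemma code_headE x c : code_head (code_cons x c) = x.
Proof.
by rewrite /code_head -[c]CodeSeq.decodeK -[code_cons _ _]/(CodeSeq.code (_ ::
  _))
  CodeSeq.codeK.
Qed.

Lemma code_tailE x c : code_tail (code_cons x c) = c.
Proof.
by rewrite /code_tail -{1}[c]CodeSeq.decodeK
  -[code_cons _ _]/(CodeSeq.code (_ :: _)) CodeSeq.codeK /= CodeSeq.decodeK.
Qed.

Lemma codeP c : c = 0 \/ exists x c', c = code_cons x c'.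
Proof.
rewrite -[c]CodeSeq.decodeK; case: (CodeSeq.decode c) => [|x s]; first by left.
by right; exists x, (CodeSeq.code s).
Qed.

Lemma iter_half_code_cons k x c :
  k <= x -> iter k half (code_cons x c) = code_cons (x - k) c.
Proof.
elim: k x => [|k IH] x; first by rewrite subn0.
move=> kx; rewrite iterS IH ?(ltnW kx) // -(subnSK kx).
by rewrite /code_cons expnS -mulnA mul2n doubleK.
Qed.

(** The head of a nonzero code is the least number of halvings that makes it odd, hence a
    minimisation. *)
Lemma recursive1_code_head : recursive1 code_head.
Proof.
have thE (v : 1.-tuple nat) : nth 0 v 0 = thead v by rewrite /thead (tnth_nth
  0).
(* Halving 0 never gives an odd number, so on the code 0 of the empty list the search is made to
   stop at [k = 0], the default head. *)
pose f n k := if n is 0 then 0 else 1 - odd (iter k half n).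
apply: (@recursive_min 1 (fun v => f (tnth v ord_max) (tnth v ord0))).
- pose g (v : 2.-tuple nat) :=
    (1 - odd (iter (tnth v ord0) half (tnth v ord_max)))
     - (1 - tnth v ord_max).
  apply: (@eq_recursive _ g) => [v|].
    by rewrite /g /f; case: (tnth v ord_max) => [|n];
      rewrite ?subn0 ?leq_subr //=;
      case: odd.
  apply: (recursive_app2 recursive2_sub);
    apply: (recursive_app2 recursive2_sub (recursive_const _ 1)).
    apply: (recursive_app1 recursive1_odd).
    apply: (recursive_app2 (recursive_iter recursive1_half));
    exact: recursive_proj.
  exact: recursive_proj.
- move=> v; rewrite !(tnth_nth 0) /= thE.
  case: (codeP (thead v)) => [->|[x [c ->]]] //.
  rewrite code_headE /f iter_half_code_cons // subnn /code_cons.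
  by rewrite mul1n /= odd_double; case: (_ * _).
- move=> v k; rewrite !(tnth_nth 0) /= thE.
  case: (codeP (thead v)) => [->|[x [c ->]]] //.
  rewrite code_headE /f => kx; rewrite iter_half_code_cons 1?ltnW //.
  have /eqP : code_cons x c != 0 by rewrite muln_eq0 negb_or -lt0n expn_gt0.
  case: (code_cons x c) => // _ _.
  by rewrite -(subnSK kx) /code_cons expnS -mulnA mul2n odd_double.
Qed.

Lemma recursive1_code_tail : recursive1 code_tail.
Proof.
apply: (@eq_recursive _ (fun v =>
  half (iter (code_head (thead v)) half (thead v)))) => [v|].
  case: (codeP (thead v)) => [->|[x [c ->]]] //.
  rewrite code_headE code_tailE iter_half_code_cons // subnn /code_cons.
  by rewrite mul1n /= uphalf_double.
apply: (recursive_app1 recursive1_half).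
exact: recursive_app2 (recursive_iter recursive1_half) recursive1_code_head
  recursive1_id.
Qed.

(** Selection from a coded list: [1 - c v] entries are dropped from the list of [f v] and [g v], and
    the head is read. *)
Lemma recursive_if n (c f g : n.-tuple nat -> nat) :
  recursive c -> recursive f -> recursive g ->
  recursive (fun v => if c v != 0 then f v else g v).
Proof.
move=> rc rf rg; apply: (@eq_recursive _ (fun v => code_head
  (iter (1 - c v) code_tail (code_cons (f v) (code_cons (g v) 0))))).
  by move=> v; case: (c v) => [|m] /=; rewrite ?code_tailE code_headE.
apply: (recursive_app1 recursive1_code_head).
apply: (recursive_app2 (recursive_iter recursive1_code_tail)).
  exact: recursive_app2 recursive2_sub (recursive_const _ _) rc.
apply: (recursive_app2 recursive2_code_cons rf).
exact: (recursive_app2 recursive2_code_cons rg (recursive_const _ 0)).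
Qed.

Lemma recursive2_eqn : recursive2 (fun m n => (m == n) : nat).
Proof.
apply: (@eq_recursive _ (fun v => 1 - ((tnth v ord0 - tnth v ord_max) +
  (tnth v ord_max - tnth v ord0)))).
  move=> v; rewrite eqn_leq -!subn_eq0.
  by move: (tnth v ord0 - _) (_ - tnth v ord0) => [|?] [|?].
apply: (recursive_app2 recursive2_sub (recursive_const _ 1)).
apply: (recursive_app2 recursive2_add); apply: (recursive_app2 recursive2_sub);
  exact: recursive_proj.
Qed.

End Recursive.

(** * Computable functions between coded types *)

Section Computable.

Lemma computableP (T U : countType) (f : T -> U) :
  computable f <->
  exists2 F, recursive1 F & forall x, F (pickle x) = pickle (f x).
Proof.
split=> [[F rF FE]|[F rF FE]].
  exists (fun n => F [tuple n]) => // .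
  apply: eq_recursive rF => v; congr F; apply: eq_from_tnth => i.
  by rewrite (ord1 i) /= /thead tnth0.
by exists (fun v => F (thead v)).
Qed.

Lemma pickle_pair (T U : countType) (x : T) (y : U) :
  pickle (x, y) = code_cons (pickle x) (code_cons (pickle y) 0).
Proof. by []. Qed.

Lemma pickle_cons (T : countType) (x : T) (s : seq T) :
  pickle (x :: s) = code_cons (pickle x) (pickle s).
Proof. by []. Qed.

Lemma eq_computable (T U : countType) (f g : T -> U) :
  f =1 g -> computable f -> computable g.
Proof. by move=> /funext ->. Qed.

Lemma computable_comp (T U V : countType) (f : U -> V) (g : T -> U) :
  computable f -> computable g -> computable (fun x => f (g x)).
Proof.
move=> /computableP[F rF FE] /computableP[G rG GE]; apply/computableP.
exists (fun x => F (G x)); first exact: recursive1_comp.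
by move=> x; rewrite GE FE.
Qed.

Lemma computable_const (T U : countType) (c : U) : computable (fun _ : T => c).
Proof.
by apply/computableP; exists (fun=> pickle c) => //; exact: recursive_const.
Qed.

Lemma computable_id (T : countType) : computable (@id T).
Proof. by apply/computableP; exists id => //; exact: recursive1_id. Qed.

Lemma computable_pair (T U V : countType) (f : T -> U) (g : T -> V) :
  computable f -> computable g -> computable (fun x => (f x, g x)).
Proof.
move=> /computableP[F rF FE] /computableP[G rG GE]; apply/computableP.
exists (fun x => code_cons (F x) (code_cons (G x) 0)).
  apply: (recursive_app2 recursive2_code_cons rF).
  exact: (recursive_app2 recursive2_code_cons rG (recursive_const _ 0)).
by move=> x; rewrite pickle_pair FE GE.
Qed.

Lemma computable_fst (T U V : countType) (f : T -> U * V) :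
  computable f -> computable (fun x => (f x).1).
Proof.
apply: computable_comp; apply/computableP; exists code_head.
  exact: recursive1_code_head.
by case=> x y; rewrite pickle_pair code_headE.
Qed.

Lemma computable_snd (T U V : countType) (f : T -> U * V) :
  computable f -> computable (fun x => (f x).2).
Proof.
apply: computable_comp; apply/computableP.
exists (fun n => code_head (code_tail n)).
  exact: recursive1_comp recursive1_code_head recursive1_code_tail.
by case=> x y; rewrite pickle_pair code_tailE code_headE.
Qed.

Lemma computable_cons (T U : countType) (f : T -> U) (g : T -> seq U) :
  computable f -> computable g -> computable (fun x => f x :: g x).
Proof.
move=> /computableP[F rF FE] /computableP[G rG GE]; apply/computableP.
exists (fun x => code_cons (F x) (G x)).
  exact: recursive_app2 recursive2_code_cons rF rG.
by move=> x; rewrite pickle_cons FE GE.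
Qed.

Lemma computable_if (T U : countType) (c : T -> bool) (f g : T -> U) :
  computable c -> computable f -> computable g ->
  computable (fun x => if c x then f x else g x).
Proof.
move=> /computableP[C rC CE] /computableP[F rF FE] /computableP[G rG GE].
apply/computableP; exists (fun x => if C x != 0 then F x else G x).
  exact: recursive_if.
by move=> x; rewrite CE FE GE; case: (c x).
Qed.

Lemma computable_and (T : countType) (c d : T -> bool) :
  computable c -> computable d -> computable (fun x => c x && d x).
Proof. by move=> cc cd; exact: computable_if cc cd (computable_const _ _). Qed.

Lemma computable_or (T : countType) (c d : T -> bool) :
  computable c -> computable d -> computable (fun x => c x || d x).
Proof. by move=> cc cd; exact: computable_if cc (computable_const _ _) cd. Qed.

Lemma computable_neg (T : countType) (c : T -> bool) :
  computable c -> computable (fun x => ~~ c x).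
Proof.
by move=> cc; exact: computable_if cc (computable_const _ _) (computable_const
  _ _).
Qed.

Lemma computable_eq (T U : countType) (f g : T -> U) :
  computable f -> computable g -> computable (fun x => f x == g x).
Proof.
move=> /computableP[F rF FE] /computableP[G rG GE]; apply/computableP.
exists (fun x => (F x == G x) : nat).
  exact: recursive_app2 recursive2_eqn rF rG.
move=> x; rewrite FE GE (inj_eq (pcan_inj choice.pickleK)).
by case: eqP.
Qed.

Lemma computable_pickle (T U : countType) (f : T -> U) :
  computable f -> computable (fun x => pickle (f x)).
Proof. by move=> /computableP[F rF FE]; apply/computableP; exists F. Qed.

(** A list of numbers is pickled by [CodeSeq.code] itself, so decoding leaves the underlying number
    unchanged. *)
Lemma computable_decode (T : countType) (f : T -> nat) :
  computable f -> computable (fun x => CodeSeq.decode (f x)).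
Proof.
move=> /computableP[F rF FE]; apply/computableP; exists F => // x.
by rewrite FE -[RHS]/(CodeSeq.code (map id _)) map_id CodeSeq.decodeK.
Qed.

Lemma computable_iter (T U : countType) (k : T -> nat) (h : U -> U)
    (z : T -> U) :
  computable k -> computable h -> computable z ->
  computable (fun x => iter (k x) h (z x)).
Proof.
move=> /computableP[K rK KE] /computableP[H rH HE] /computableP[Z rZ ZE].
apply/computableP; exists (fun x => iter (K x) H (Z x)).
  exact: recursive_app2 (recursive_iter rH) rK rZ.
move=> x; rewrite KE ZE.
have -> : pickle (k x) = k x by [].
by elim: (k x) => //= n ->.
Qed.

Lemma size_le_pickle (T : countType) (s : seq T) : size s <= pickle s.
Proof.
elim: s => //= x s IH; rewrite pickle_cons /code_cons.
apply: (@leq_trans (pickle s).*2.+1); last by rewrite leq_pmull // expn_gt0.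
by rewrite ltnS (leq_trans IH) // -addnn leq_addr.
Qed.

(* The fold runs as a fixed step iterated [pickle s] times, which is enough
   since [pickle s >= size s]. *)
Lemma computable_foldl (T U V : countType) (g : T -> V -> U -> V) (z : T -> V)
    (s : T -> seq U) :
  computable (fun p : T * V * U => g p.1.1 p.1.2 p.2) ->
  computable z -> computable s ->
  computable (fun x => foldl (g x) (z x) (s x)).
Proof.
move=> cg cz cs.
(* The state holds the unread list, the parameter and the accumulator. It is fixed once the list is
   empty, so surplus iterations are harmless. *)
pose step (p : seq U * (T * V)) :=
  if p.1 is y :: s' then (s', (p.2.1, g p.2.1 p.2.2 y)) else p.
have cstep : computable step.
  case/computableP: cg => G rG GE; apply/computableP.
  pose hd n := code_head n.
  pose tl n := code_head (code_tail n).
  have rhd : recursive1 hd by exact: recursive1_code_head.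
  have rtl : recursive1 tl.
    exact: recursive1_comp recursive1_code_head recursive1_code_tail.
  pose pr m n := code_cons m (code_cons n 0).
  have rpr : recursive2 pr.
    apply: (recursive_app2 recursive2_code_cons recursive2_fst).
    exact: (recursive_app2 recursive2_code_cons recursive2_snd
      (recursive_const _ 0)).
  pose new n := pr (code_tail (hd n))
    (pr (hd (tl n)) (G (pr (pr (hd (tl n)) (tl (tl n))) (code_head (hd n))))).
  exists (fun n => if hd n != 0 then new n else n).
    apply: recursive_if => //; last exact: recursive1_id.
    apply: (recursive_app2 rpr);
      first exact: recursive1_comp recursive1_code_tail rhd.
    have rt := recursive1_comp rhd rtl.
    apply: (recursive_app2 rpr rt); apply: (recursive_app1 rG).
    apply: (recursive_app2 rpr);
      last exact: recursive1_comp recursive1_code_head rhd.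
    exact: (recursive_app2 rpr rt (recursive1_comp rtl rtl)).
  case=> [[|y s'] [x v]].
    by rewrite /hd pickle_pair code_headE.
  rewrite pickle_pair /new /hd /tl !(code_headE, code_tailE).
  rewrite ifT; last by rewrite muln_eq0 negb_or -lt0n expn_gt0.
  by rewrite -[pr (pr _ _) _]/(pickle (x, v, y)) GE.
apply: (@eq_computable _ _ (fun x =>
  (iter (pickle (s x)) step (s x, (x, z x))).2.2)).
  move=> x; have := size_le_pickle (s x); move: (pickle _) => n.
  elim: n (z x) (s x) => [|n IH] v [|y r] // szr.
    by rewrite iterSr (IH v [::]).
  by rewrite iterSr /= -(IH (g x v y) r).
do 2![apply: computable_snd];
  apply: (computable_iter (computable_pickle cs) cstep).
by apply: computable_pair => //; apply: computable_pair => //;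
  exact: computable_id.
Qed.

Lemma computable_rev (T U : countType) (s : T -> seq U) :
  computable s -> computable (fun x => rev (s x)).
Proof.
move=> cs; apply: (@eq_computable _ _ (fun x =>
  foldl (fun v y => y :: v) [::] (s x))).
  move=> x; rewrite /rev; elim: (s x) [::] => //= y r IH v.
apply: (@computable_foldl _ _ _ (fun _ v y => y :: v)) => //.
  apply: computable_cons; first exact: computable_snd (computable_id _).
  exact: computable_snd (computable_fst (computable_id _)).
exact: computable_const.
Qed.

Lemma computable_foldr (T U V : countType) (g : T -> U -> V -> V) (z : T -> V)
    (s : T -> seq U) :
  computable (fun p : T * U * V => g p.1.1 p.1.2 p.2) ->
  computable z -> computable s ->
  computable (fun x => foldr (g x) (z x) (s x)).
Proof.
move=> cg cz cs; apply: (@eq_computable _ _ (fun x =>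
  foldl (fun v y => g x y v) (z x) (rev (s x)))) => [x|].
  by rewrite foldl_rev.
apply: (@computable_foldl _ _ _ (fun x v y => g x y v)) => //.
  apply: (@computable_comp _ (T * U * V)%type _ _
    (fun p : T * V * U => (p.1.1, p.2, p.1.2)) cg).
  have c := computable_id (T * V * U)%type.
  apply: computable_pair; last exact: computable_snd (computable_fst c).
  apply: computable_pair; last exact: computable_snd c.
  exact: computable_fst (computable_fst c).
exact: computable_rev.
Qed.


Lemma computable_cat (T U : countType) (s1 s2 : T -> seq U) :
  computable s1 -> computable s2 -> computable (fun x => s1 x ++ s2 x).
Proof.
move=> c1 c2; apply: (@eq_computable _ _ (fun x =>
  foldr (fun y s => y :: s) (s2 x) (s1 x))) => [x|];
    first by elim: (s1 x) => //= y s ->.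
apply: (@computable_foldr _ _ _ (fun _ y s => y :: s)) => //.
have c := computable_id (T * U * seq U)%type.
exact: computable_cons (computable_snd (computable_fst c)) (computable_snd c).
Qed.

Lemma computable_map (T U V : countType) (h : T -> U -> V) (s : T -> seq U) :
  computable (fun p : T * U => h p.1 p.2) -> computable s ->
  computable (fun x => map (h x) (s x)).
Proof.
move=> ch cs; apply: (@eq_computable _ _ (fun x =>
  foldr (fun y r => h x y :: r) [::] (s x))).
  by move=> x; elim: (s x) => //= y r ->.
apply: (@computable_foldr _ _ _ (fun x y r => h x y :: r)) => //.
  have c := computable_id (T * U * seq V)%type.
  by apply: computable_cons (computable_snd c);
    exact: computable_comp ch (computable_fst c).
exact: computable_const.
Qed.

Lemma computable_filter (T U : countType) (h : T -> U -> bool) (s : T -> seq U)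
  :
  computable (fun p : T * U => h p.1 p.2) -> computable s ->
  computable (fun x => filter (h x) (s x)).
Proof.
move=> ch cs; apply: (@eq_computable _ _ (fun x =>
  foldr (fun y r => if h x y then y :: r else r) [::] (s x))).
  by move=> x; elim: (s x) => //= y r ->.
apply: (@computable_foldr _ _ _ (fun x y r => if h x y then y :: r else r)) =>
  //.
  have c := computable_id (T * U * seq U)%type.
  apply: computable_if; last exact: computable_snd c.
    exact: computable_comp ch (computable_fst c).
  exact: computable_cons (computable_snd (computable_fst c)) (computable_snd c).
exact: computable_const.
Qed.

Lemma computable_flatten (T U : countType) (s : T -> seq (seq U)) :
  computable s -> computable (fun x => flatten (s x)).
Proof.
move=> cs.
apply: (@computable_foldr _ _ _ (fun _ => @cat U)) => //.
  have c := computable_id (T * seq U * seq U)%type.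
  exact: computable_cat (computable_snd (computable_fst c)) (computable_snd c).
exact: computable_const.
Qed.

(** The fold carries the suffix already read along with the verdict, because each entry is compared
    with all later ones. *)
Lemma computable_pairwise (T U : countType) (h : T -> U -> U -> bool)
    (s : T -> seq U) :
  computable (fun p : T * U * U => h p.1.1 p.1.2 p.2) -> computable s ->
  computable (fun x => pairwise (h x) (s x)).
Proof.
move=> ch cs.
pose all_h x y r := foldr (fun z b => h x y z && b) true r.
pose step x y (a : seq U * bool) := (y :: a.1, all_h x y a.1 && a.2).
apply: (@eq_computable _ _ (fun x =>
  (foldr (step x) ([::], true) (s x)).2)).
  move=> x.
  have -> // : foldr (step x) ([::], true) (s x) = (s x, pairwise (h x) (s x)).
  by elim: (s x) => [//|y r] /= ->; congr (_, _ && _).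
apply: computable_snd; apply: (computable_foldr _ (computable_const _ _) cs).
have c := computable_id (T * U * (seq U * bool))%type.
have ct := computable_snd c.
have cu := computable_fst c.
apply: computable_pair.
  exact: computable_cons (computable_snd cu) (computable_fst ct).
apply: computable_and (computable_snd ct).
apply: (@computable_foldr _ _ _
  (fun p z b => h p.1.1 p.1.2 z && b)) (computable_const _ _) (computable_fst
    ct).
have c' := computable_id (T * U * (seq U * bool) * U * bool)%type.
apply: computable_and (computable_snd c').
apply: (@computable_comp _ _ _ _
  (fun q : T * U * (seq U * bool) * U * bool => (q.1.1.1, q.1.2)) ch).
apply: computable_pair; last exact: computable_snd (computable_fst c').
exact: computable_fst (computable_fst (computable_fst c')).
Qed.

Lemma computable_all (T U : countType) (h : T -> U -> bool) (s : T -> seq U) :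
  computable (fun p : T * U => h p.1 p.2) -> computable s ->
  computable (fun x => all (h x) (s x)).
Proof.
move=> ch cs; apply: (@eq_computable _ _ (fun x =>
  foldr (fun y b => h x y && b) true (s x))).
  by move=> x; elim: (s x) => //= y r ->.
apply: (@computable_foldr _ _ _ (fun x y b => h x y && b)) => //.
  have c := computable_id (T * U * bool)%type.
  by apply: computable_and (computable_snd c);
    exact: computable_comp ch (computable_fst c).
exact: computable_const.
Qed.

Lemma computable_has (T U : countType) (h : T -> U -> bool) (s : T -> seq U) :
  computable (fun p : T * U => h p.1 p.2) -> computable s ->
  computable (fun x => has (h x) (s x)).
Proof.
move=> ch cs.
apply: (@eq_computable _ _ (fun x => ~~ all (fun y => ~~ h x y) (s x))).
  by move=> x; rewrite -has_predC; apply: eq_has => y /=; rewrite negbK.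
apply/computable_neg/(@computable_all _ _ (fun x y => ~~ h x y)) => //.
exact: computable_neg.
Qed.

Lemma computable_mem (T U : countType) (f : T -> U) (s : T -> seq U) :
  computable f -> computable s -> computable (fun x => f x \in s x).
Proof.
move=> cf cs.
apply: (@eq_computable _ _ (fun x => has (fun y => f x == y) (s x))).
  by move=> x; rewrite -has_pred1; apply: eq_has => y; rewrite eq_sym.
apply: (@computable_has _ _ (fun x y => f x == y)) => //.
have c := computable_id (T * U)%type.
exact: computable_eq (computable_comp cf (computable_fst c)) (computable_snd c).
Qed.

(** A function on a finite type is a finite table, built by induction on the enumeration of [T]. *)
Lemma computable_finType (T : finType) (U V : countType) (h : T -> V)
    (f : U -> T) :
  computable f -> computable (fun x => h (f x)).
Proof.
apply: computable_comp.
suff [g cg gE] : exists2 g : T -> V, computable g & {in enum T, g =1 h}.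
  by apply: eq_computable cg => x; rewrite gE // mem_enum.
elim: (enum T) => [|t s [g cg gE]].
  have [[t]|noT] := pselect (inhabited T).
    by exists (fun=> h t) => //; exact: computable_const.
  by exists h => //; apply/computableP; exists id => [|t];
    [exact: recursive1_id | case: noT].
exists (fun x => if x == t then h t else g x).
  apply: computable_if cg; last exact: computable_const.
  exact: computable_eq (computable_id _) (computable_const _ _).
by move=> x; rewrite inE; case: eqP => [->|_] //= /gE.
Qed.

End Computable.

(** * Decidable sets of codes and unbounded search *)

Lemma algorithmic_computable (T : countType) (d : T -> bool) :
  computable d -> algorithmic (fun x => d x).
Proof. by exists d. Qed.

(* Unbounded search must be total on all of [nat], so it has to recognise the
   numbers that code nothing. *)
Definition effective (T : countType) : Prop :=
  algorithmic [set n : nat | exists x : T, pickle x = n]%classic.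

Section Effective.

Lemma effective_fin (T : finType) : effective T.
Proof.
exists (fun n => n \in map pickle (enum T)).
  exact: computable_mem (computable_id _) (computable_const _ _).
move=> n; split=> [[x <-]|/mapP[x _ ->]]; last by exists x.
by rewrite map_f // mem_enum.
Qed.

Lemma effective_seq (T : countType) : effective T -> effective (seq T).
Proof.
case=> d cd dP; exists (fun n => all d (CodeSeq.decode n)).
  apply: (@computable_all _ _ (fun=> d)).
    exact: computable_comp cd (computable_snd (computable_id _)).
  exact: computable_decode (computable_id _).
move=> n; split=> [[s <-]|].
  rewrite -[pickle s]/(CodeSeq.code (map _ _)) CodeSeq.codeK all_map.
  by apply/allP => x _; apply/dP; exists x.
suff decP s : all d s -> exists x : seq T, pickle x = CodeSeq.code s.
  by move=> /decP; rewrite CodeSeq.decodeK.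
elim: s => [_|m s IH /= /andP[/dP[x <-] /IH[r rE]]]; first by exists [::].
by exists (x :: r); rewrite pickle_cons rE.
Qed.

Lemma effective_pair (T U : countType) :
  effective T -> effective U -> effective (T * U)%type.
Proof.
case=> dT cT dTP [dU cU dUP].
pose hd n := code_head n.
pose tl n := code_head (code_tail n).
have chd : computable hd.
  by apply/computableP; exists hd => //; exact: recursive1_code_head.
have ctl : computable tl.
  apply/computableP; exists tl => //.
  exact: recursive1_comp recursive1_code_head recursive1_code_tail.
(* The first test rejects numbers that do not code a two-element list: extracting two components and
   coding them again must return [n]. *)
exists (fun n => [&& n == pickle (hd n, tl n), dT (hd n) & dU (tl n)]).
  apply: computable_and; last apply: computable_and.
  - apply: computable_eq; first exact: computable_id.
    by apply: computable_pickle; exact: computable_pair.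
  - exact: computable_comp.
  - exact: computable_comp.
move=> n; split=> [[[x y] <-]|].
  rewrite pickle_pair /hd /tl code_tailE !code_headE eqxx /=.
  by apply/andP; split; [apply/dTP; exists x | apply/dUP; exists y].
case/and3P=> /eqP nE /dTP[x xE] /dUP[y yE].
by exists (x, y); rewrite [RHS]nE !pickle_pair xE yE.
Qed.

Lemma computable_choice (T U : countType) (R : set (T * U)) :
  effective T -> effective U -> algorithmic R ->
  (forall x, exists u, R (x, u)) ->
  exists2 h : T -> U, computable h & forall x, R (x, h x).
Proof.
case=> dT /computableP[FT rT FTE] dTP [dU /computableP[FU rU FUE] dUP].
case=> d /computableP[F rF FE] dP totR.
pose pr m n := code_cons m (code_cons n 0).
(* If [n] codes no element of [T], every [k] is accepted, which makes the search total. Otherwise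
   [k] must code an element of [U], since [F] is unconstrained on other numbers. *)
pose good n k := (FT n == 0) || (FU k != 0) && (F (pr n k) != 0).
have goodP n : exists k, good n k.
  rewrite /good; case: (boolP (dT n)) (FTE n) => [/dTP[x <-]|_] /= ->.
    have [u /dP Ru] := totR x; exists (pickle u).
    rewrite FUE -[pr _ _]/(pickle (x, u)) FE Ru /=.
    suff -> : dU (pickle u) by [].
    by apply/dUP; exists u.
  by exists 0; rewrite eqxx.
pose m n := ex_minn (goodP n).
have rm : recursive1 m.
  apply: (@recursive_min 1 (fun v =>
    1 - good (tnth v ord_max) (tnth v ord0))).
  - apply: (recursive_app2 recursive2_sub (recursive_const _ 1)).
    pose c (v : 2.-tuple nat) := if FT (tnth v ord_max) != 0 then
      if FU (tnth v ord0) != 0 then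
        if F (pr (tnth v ord_max) (tnth v ord0)) != 0 then 1 else 0
      else 0 else 1.
    apply: (@eq_recursive _ c) => [v|].
      by rewrite /c /good; do 3![case: eqP => //=].
    have r0 := @recursive_proj 2 ord0.
    have r1 := @recursive_proj 2 ord_max.
    do 3?[apply: recursive_if; try exact: recursive_const];
      try exact: recursive_app1.
    apply: (recursive_app1 rF); apply: (recursive_app2 recursive2_code_cons r1).
    exact: (recursive_app2 recursive2_code_cons r0 (recursive_const _ 0)).
  - move=> v; rewrite !(tnth_nth 0) /= -(tnth_nth 0 v ord0) -/(thead v).
    by rewrite /m; case: ex_minnP => k ->.
  - move=> v k; rewrite !(tnth_nth 0) /= -(tnth_nth 0 v ord0) -/(thead v).
    rewrite /m; case: ex_minnP => k' _ mink' kk'.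
    by case: (boolP (good _ _)) => // /mink'; rewrite leqNgt kk'.
have mP x : exists u, pickle u = m (pickle x) /\ R (x, u).
  rewrite /m; case: ex_minnP => k; rewrite /good FTE.
  have -> : dT (pickle x) by apply/dTP; exists x.
  rewrite FUE /= => /andP[+ Fk] _.
  case: (boolP (dU k)) => // /dUP[u uE] _; exists u; split=> //.
  by apply/dP; move: Fk; rewrite -uE -[pr _ _]/(pickle (x, u)) FE; case: (d _).
exists (fun x => sval (cid (mP x))) => [|x]; last first.
  by case: cid => u [].
by apply/computableP; exists m => // x; case: cid => u [].
Qed.

(** Some certificate [u] exists for every [x], so one can be computed by unbounded search; given any
    certificate, [P x] reduces to the decidable [Q (x, u)]. *)
Lemma algorithmic_search (T U : countType) (R Q : set (T * U)) (P : set T) :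
  effective T -> effective U -> algorithmic R -> algorithmic Q ->
  (forall x, exists u, R (x, u)) ->
  (forall x u, R (x, u) -> (P x <-> Q (x, u))) -> algorithmic P.
Proof.
move=> eT eU aR [d cd dP] totR PQ.
have [h ch hR] := computable_choice eT eU aR totR.
exists (fun x => d (x, h x)).
  exact: computable_comp cd (computable_pair (computable_id _) ch).
by move=> x; rewrite (PQ _ _ (hR x)); exact: dP.
Qed.

End Effective.

(** * Automation for computability goals *)

Ltac computability_step :=
  match goal with
  | |- @computable _ _ (fun x => x) => apply: computable_id
  | |- @computable _ _ (fun _ => ?c) => apply: computable_const
  | |- @computable _ _ (@fst _ _) => exact: (computable_fst (computable_id _))
  | |- @computable _ _ (@snd _ _) => exact: (computable_snd (computable_id _))
  | |- @computable _ _ (fun x => fst (@?f x)) => apply: computable_fst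
  | |- @computable _ _ (fun x => snd (@?f x)) => apply: computable_snd
  | |- @computable _ _ (fun x => (@?f x, @?g x)) => apply: computable_pair
  | |- @computable _ _ (fun x => cons (@?f x) (@?g x)) => apply: computable_cons
  | |- @computable _ _ (fun x => cat (@?f x) (@?g x)) => apply: computable_cat
  | |- @computable _ _ (fun x => flatten (@?f x)) => apply: computable_flatten
  | |- @computable _ _ (fun x => rev (@?f x)) => apply: computable_rev
  | |- @computable _ _ (fun x => map (@?h x) (@?s x)) =>
      refine (@computable_map _ _ _ h s _ _); cbv beta
  | |- @computable _ _ (fun x => filter (@?h x) (@?s x)) =>
      refine (@computable_filter _ _ h s _ _); cbv beta
  | |- @computable _ _ (fun x => foldr (@?h x) (@?z x) (@?s x)) =>
      refine (@computable_foldr _ _ _ h z s _ _ _); cbv beta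
  | |- @computable _ _ (fun x => pairwise (@?h x) (@?s x)) =>
      refine (@computable_pairwise _ _ h s _ _); cbv beta
  | |- @computable _ _ (fun x => all (@?h x) (@?s x)) =>
      refine (@computable_all _ _ h s _ _); cbv beta
  | |- @computable _ _ (fun x => has (@?h x) (@?s x)) =>
      refine (@computable_has _ _ h s _ _); cbv beta
  | |- @computable _ _ (fun x => andb (@?f x) (@?g x)) => apply: computable_and
  | |- @computable _ _ (fun x => orb (@?f x) (@?g x)) => apply: computable_or
  | |- @computable _ _ (fun x => eq_op (@?f x) (@?g x)) => apply: computable_eq
  | |- @computable _ _ (fun x => negb (@?f x)) => apply: computable_neg
  | |- @computable _ _ (fun x => in_mem (@?f x) (mem (@?s x))) =>
      apply: computable_mem
  | H : @computable _ _ ?d |- @computable _ _ (fun x => ?d (@?f x)) =>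
      refine (@computable_comp _ _ _ d f H _)
  end.

Ltac computability := repeat computability_step.

Local Open Scope group_scope.

(** * Conjugacy in the wreath product *)

(** Finite choice, recorded as a list of pairs over [P]; it assembles partners of single entries
    into a matching. *)
Lemma choose_partners (T U : eqType) (P : seq T) (Q : seq U)
    (r : T -> U -> Prop) :
  {in P, forall p, exists2 q, q \in Q & r p q} ->
  exists z, [/\ unzip1 z = P, {subset unzip2 z <= Q} &
    {in z, forall x, r x.1 x.2}].
Proof.
elim: P => [|p P IH] rP; first by exists [::].
have [|z [zP zQ rz]] := IH; first by move=> x xP; apply: rP;
  rewrite inE xP orbT.
have [q qQ pq] := rP _ (mem_head _ _).
exists ((p, q) :: z); split=> [|x|x] /=; first by rewrite zP.
  by rewrite inE => /orP[/eqP->|/zQ].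
by rewrite inE => /orP[/eqP->|/rz].
Qed.

Lemma pairwise_mem (T : eqType) (r : rel T) s x y :
  pairwise r s -> x \in s -> y \in s -> [|| x == y, r x y | r y x].
Proof.
elim: s => [//|z s IH] /= /andP[/allP zs ds]; rewrite !inE.
case/orP=> [/eqP->|xs] /orP[/eqP->|ys].
- by rewrite eqxx.
- by rewrite (zs _ ys) orbT.
- by rewrite (zs _ xs) !orbT.
- exact: IH.
Qed.

(** * Cyclic subgroups and their orbits *)

Section CyclicSubgroup.

Context {B : groupType}.
Implicit Types b c : B.

Lemma cyclic_subgroup1 b : cyclic_subgroup b 1.
Proof. by exists 0; left. Qed.

Lemma cyclic_subgroup_id b : cyclic_subgroup b b.
Proof. by exists 1%N; left. Qed.

Lemma cyclic_subgroupX b k : cyclic_subgroup b (b ^+ k).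
Proof. by exists k; left. Qed.

Lemma cyclic_subgroupV b c : cyclic_subgroup b c -> cyclic_subgroup b c^-1.
Proof. by case=> k [] ->; exists k; [right | left; rewrite invgK]. Qed.

Lemma cyclic_subgroupXM b c k :
  cyclic_subgroup b c -> cyclic_subgroup b (b ^+ k * c).
Proof.
case=> l [] ->; first by exists (k + l); left; rewrite expgnDr.
have [lk|/ltnW kl] := leqP l k.
  by exists (k - l); left; rewrite expgnFr.
by exists (l - k); right; rewrite expgnFr // invgM invgK.
Qed.

Lemma cyclic_subgroup_commute b c : cyclic_subgroup b c -> commute b c.
Proof.
have cb k : commute b (b ^+ k) by apply/commuteX/commute_refl.
by case=> k [] -> //; exact: commuteV.
Qed.

Lemma cyclic_subgroupM b c d :
  cyclic_subgroup b c -> cyclic_subgroup b d -> cyclic_subgroup b (c * d).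
Proof.
case=> k [] -> bd; first exact: cyclic_subgroupXM.
rewrite -[d]invgK -invgM; apply: cyclic_subgroupV.
have -> : d^-1 * b ^+ k = b ^+ k * d^-1.
  apply/commute_sym/commuteV/commute_sym/commuteX/commute_sym.
  exact: cyclic_subgroup_commute.
exact/cyclic_subgroupXM/cyclic_subgroupV.
Qed.

End CyclicSubgroup.

Section Orbits.

Context {B : groupType} {S : Type} (to : right_action B S).
Implicit Types (b c : B) (s t : S).

Local Notation orbit b s t := (cyclic_orbit to b s t).

Lemma ractK b s : to (to s b) b^-1 = s.
Proof. by rewrite -ractM mulgV ract1. Qed.

Lemma ractKV b s : to (to s b^-1) b = s.
Proof. by rewrite -ractM mulVg ract1. Qed.

Lemma cyclic_orbit_refl b s : orbit b s s.
Proof. by exists 1; [exact: cyclic_subgroup1 | rewrite ract1]. Qed.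

Lemma cyclic_orbit_sym b s t : orbit b s t -> orbit b t s.
Proof. by case=> c bc <-; exists c^-1;
  [exact: cyclic_subgroupV | rewrite ractK]. Qed.

Lemma cyclic_orbit_trans b s t u : orbit b s t -> orbit b t u -> orbit b s u.
Proof.
case=> c bc <- [d bd <-]; exists (c * d); last by rewrite ractM.
exact: cyclic_subgroupM.
Qed.

Lemma cyclic_orbitX b s k : orbit b s (to s (b ^+ k)).
Proof. by exists (b ^+ k) => //; exact: cyclic_subgroupX. Qed.

Lemma cyclic_orbitV b s : orbit b s (to s b^-1).
Proof. by exists b^-1 => //; exact/cyclic_subgroupV/cyclic_subgroup_id. Qed.

Lemma cyclic_orbit_eq b s t : orbit b s t -> cyclic_orbit to b s = cyclic_orbit
  to b t.
Proof.
move=> st; apply/seteqP; split=> u; last exact: cyclic_orbit_trans.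
exact/cyclic_orbit_trans/cyclic_orbit_sym.
Qed.

(** Powers of [b] commute with [c], so [c] carries [b]-orbits to [b]-orbits and [c^-1] carries them
    back. *)
Lemma cyclic_orbit_commute b c s t :
  commute c b -> orbit b (to s c) (to t c) <-> orbit b s t.
Proof.
move=> cb; split=> -[d bd]; last first.
  move=> <-; exists d => //; rewrite -!ractM; congr (to _ _);
    move: bd => [k []->];
    [exact: commuteX | exact/commuteV/commuteX].
rewrite -ractM => /(congr1 (to^~ c^-1)); rewrite ractK => <-; exists d => //.
rewrite -[RHS]ractM; congr (to _ _); rewrite -mulgA.
suff -> : d * c^-1 = c^-1 * d by rewrite mulVKg.
apply/commuteV/commute_sym.
by move: bd => [k []->]; [exact: commuteX | exact/commuteV/commuteX].
Qed.

End Orbits.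

(** * Conjugacy of base functions over a fixed element of [B] *)

Section BaseConjugacy.

Context {A B : groupType} {S : choiceType} (to : right_action B S).
Implicit Types (b c : B) (s t : S) (f g : {fsfun S -> A with 1}).

Local Notation base := {fsfun S -> A with 1}.
Local Notation base1 := ([fsfun of _ => 1] : base).
Local Notation orbit b s t := (cyclic_orbit to b s t).

(* Conjugacy of [(b, f)] and [(b, f')] by an element [(1, g)]. *)
Definition base_conj b f f' : Prop :=
  exists g : base, forall s, f' s = (g (to s b^-1))^-1 * f s * g s.

(** With [z = (c, g)], the equation [x * z = z * y] separates into its component in [B] and its
    component in the base group. *)
Lemma wreath_conjP (x y : wreath A to) :
  (exists z, x ^ z = y) <->
  exists2 c, x.1 * c = c * y.1 & base_conj y.1 (base_act to x.2 c) y.2.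
Proof.
have E (z : wreath A to) : x ^ z = y <-> x * z = z * y.
  by rewrite conjgE; split=> [<-|->]; rewrite ?mulVKg ?mulKg.
case: x y E => [b f] [b' f'] E; split=> /=.
  case=> -[c g] /E[bc fg]; exists c => //; exists g => s.
  move/(congr1 (fun h : base => h s)): fg.
  by rewrite !(base_mulE, base_actE) -mulgA => ->; rewrite mulKg.
case=> c bc [g gP]; exists (c, g); apply/E; congr pair => //=.
by apply/fsfunP => s; rewrite !(base_mulE, base_actE) gP base_actE -mulgA
  mulVKg.
Qed.

Lemma base_conj_refl b f : base_conj b f f.
Proof. by exists base1 => s; rewrite !fsfunE invg1 mul1g mulg1. Qed.

Lemma base_conj_sym b f f' : base_conj b f f' -> base_conj b f' f.
Proof.
case=> g gP; exists (base_inv g) => s.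
by rewrite !base_invE gP invgK -!mulgA mulVKg mulgV mulg1.
Qed.

Lemma base_conj_trans b f f' f'' :
  base_conj b f f' -> base_conj b f' f'' -> base_conj b f f''.
Proof.
case=> g gP [h hP]; exists (base_mul g h) => s.
by rewrite !base_mulE hP gP invgM !mulgA.
Qed.

(** The conjugator is [(f s)^-1] at [s] and trivial elsewhere: it cancels the value at [s] and
    multiplies it from the left onto the next point. A fixed point [s] would receive both effects at
    once. *)
Lemma base_conj_push b f f' s : to s b != s ->
  (forall t, f' t = if t == s then 1
                    else if t == to s b then f s * f (to s b) else f t) ->
  base_conj b f f'.
Proof.
move=> sbs f'E; exists (base_delta (f s)^-1 s) => t; rewrite f'E !base_deltaE.
have [->|ts] := eqVneq t s.
  rewrite ifN; first by rewrite invg1 mul1g mulgV.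
  by apply: contra sbs => /eqP {1}<-; rewrite ractKV.
have [->|tsb] := eqVneq t (to s b); first by rewrite ractK eqxx invgK mulg1.
rewrite ifN; first by rewrite invg1 mul1g mulg1.
by apply: contra tsb => /eqP <-; rewrite ractKV.
Qed.

Lemma base_conj_shift b f s a :
  (forall t, orbit b s t -> f t = 1) ->
  base_conj b (base_mul f (base_delta a s)) (base_mul f (base_delta a (to s
    b))).
Proof.
move=> fs; have [->|sbs] := eqVneq (to s b) s; first exact: base_conj_refl.
have fs1 : f s = 1 by apply/fs/cyclic_orbit_refl.
have fsb1 : f (to s b) = 1 by apply: fs; exact: (cyclic_orbitX to b s 1%N).
apply: (base_conj_push sbs) => t; rewrite !(base_mulE, base_deltaE) eqxx.
rewrite (negPf sbs) fs1 fsb1 !mul1g mulg1.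
have [->|ts] := eqVneq t s; first by rewrite fs1 eq_sym (negPf sbs) mul1g.
by have [->|tsb] := eqVneq t (to s b); rewrite ?fsb1 ?mul1g.
Qed.

(** Repeated shifts handle positive powers. For a negative power the shifts lead from [t] to [s],
    and symmetry concludes. *)
Lemma base_conj_move b f s t a :
  (forall u, orbit b s u -> f u = 1) -> orbit b s t ->
  base_conj b (base_mul f (base_delta a s)) (base_mul f (base_delta a t)).
Proof.
move=> fs [c [k kP] <-].
have up s' k' : orbit b s s' -> base_conj b (base_mul f (base_delta a s'))
    (base_mul f (base_delta a (to s' (b ^+ k')))).
  move=> ss'; elim: k' => [|k' IH]; first by rewrite ract1;
    exact: base_conj_refl.
  apply: base_conj_trans IH _; rewrite expgSr ractM; apply: base_conj_shift.
  move=> u; rewrite -(cyclic_orbit_eq (cyclic_orbitX to b s' k')).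
  by rewrite -(cyclic_orbit_eq ss'); exact: fs.
case: kP => ->; first exact/up/cyclic_orbit_refl.
apply: base_conj_sym; rewrite -{2}[s](ractKV to (b ^+ k)); apply: up.
by exists (b ^- k) => //; exact/cyclic_subgroupV/cyclic_subgroupX.
Qed.

(** The conjugator is [x] on the whole orbit and trivial elsewhere; finiteness of the orbit gives it
    finite support. *)
Lemma base_conj_finite b f s a x :
  finite_set (cyclic_orbit to b s) -> (forall u, orbit b s u -> f u = 1) ->
  base_conj b (base_mul f (base_delta a s)) (base_mul f (base_delta (a ^ x) s)).
Proof.
move=> finO fs.
pose g : base := [fsfun t in fset_set (cyclic_orbit to b s) => x | 1].
have gE t : g t = if `[< orbit b s t >] then x else 1.
  by rewrite fsfunE in_fset_set.
exists g => t; rewrite !gE !(base_mulE, base_deltaE).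
have -> : `[< orbit b s (to t b^-1) >] = `[< orbit b s t >].
  apply: asbool_equiv_eq; split=> h; apply: cyclic_orbit_trans h _.
    exact/cyclic_orbit_sym/cyclic_orbitV.
  exact: cyclic_orbitV.
case: asboolP => [/fs ->|ts]; last by
  case: eqP ts => [->[]|_ _];
    [exact: cyclic_orbit_refl | rewrite invg1 mul1g !mulg1].
by rewrite !mul1g; case: eqP => _; rewrite ?mulg1 ?mulVg // conjgE mulgA.
Qed.

Lemma prod_single n (F : nat -> A) i :
  i < n -> (forall j, j < n -> j != i -> F j = 1) -> \prod_(j < n) F j = F i.
Proof.
move=> ilt F1; rewrite (@big_only1 _ _ _ _ (Ordinal ilt)) // => j ji _.
by apply: F1.
Qed.

(** Consecutive factors telescope: the right factor [g] at one point cancels the inverse on the left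
    at the next. *)
Lemma base_conj_prod b f f' g y n :
  (forall s, f' s = (g (to s b^-1))^-1 * f s * g s) ->
  \prod_(j < n) f' (to y (b ^+ j.+1)) =
  (g y)^-1 * (\prod_(j < n) f (to y (b ^+ j.+1))) * g (to y (b ^+ n)).
Proof.
move=> gP; elim: n => [|n IH].
  by rewrite !big_ord0 mulg1 ract1 mulVg.
rewrite !big_ord_recr /= IH gP -ractM [in X in to y (X * _)]expgSr mulgK.
by rewrite -!mulgA mulVKg.
Qed.

Lemma cyclic_orbit_period b s t n :
  (0 < n)%N -> to s (b ^+ n) = s -> orbit b s t ->
  exists2 j, (j < n)%N & t = to s (b ^+ j).
Proof.
move=> n0 sn.
have snk k : to s (b ^+ (n * k)) = s.
  elim: k => [|k IH]; first by rewrite muln0 ract1.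
  by rewrite mulnS expgnDr ractM sn.
have pow k : exists2 j, (j < n)%N & to s (b ^+ k) = to s (b ^+ j).
  exists (k %% n)%N; first by rewrite ltn_mod.
  by rewrite {1}(divn_eq k n) expgnDr ractM mulnC snk.
case=> _ [k [] ->] <-; first exact: pow.
(* A multiple of the period makes the exponent nonnegative. *)
have -> : to s (b ^- k) = to s (b ^+ (n * k - k)).
  by rewrite expgnFr ?leq_pmull // ractM snk.
exact: pow.
Qed.

Lemma finite_cyclic_orbit b s n :
  (0 < n)%N -> to s (b ^+ n) = s -> finite_set (cyclic_orbit to b s).
Proof.
move=> n0 sn.
apply: (@sub_finite_set _ _ [set` [seq to s (b ^+ j) | j <- iota 0 n]]%classic).
  move=> t /(cyclic_orbit_period n0 sn)[j jn ->].
  by apply/mapP; exists j; rewrite // mem_iota.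
exact: finite_seq.
Qed.

Lemma ractX_inj b s n i j :
  (forall k, (0 < k < n)%N -> to s (b ^+ k) <> s) -> (i < n)%N -> (j < n)%N ->
  to s (b ^+ i) = to s (b ^+ j) -> i = j.
Proof.
move=> sn; wlog ij : i j / (i <= j)%N => [wl|] iN jN sij.
  by case/orP: (leq_total i j) => ?; [exact: wl | apply/esym/wl].
apply/eqP; rewrite eqn_leq ij leqNgt -subn_gt0; apply/negP => ji0.
have /sn[] : (0 < j - i < n)%N by rewrite ji0 (leq_ltn_trans (leq_subr _ _)).
by rewrite expgnFr // ractM -sij ractK.
Qed.

(** Each of the finitely many support points is met at most once. Applied along an infinite orbit,
    this yields points where the conjugator is trivial. *)
Lemma finsupp_escape f (e : nat -> S) :
  injective e -> exists N, forall k, (N <= k)%N -> f (e k) = 1.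
Proof.
move=> einj.
suff XP (X : seq S) : exists N, forall k, (N <= k)%N -> e k \notin X.
  by have [N NP] := XP (finsupp f); exists N => k /NP /fsfun_dflt.
elim: X => [|x X [N NP]]; first by exists 0%N.
have [[k0 ek0]|noe] := pselect (exists k, e k = x).
  exists (maxn N k0.+1) => k; rewrite geq_max inE negb_or => /andP[/NP -> k0k].
  by rewrite -ek0 (inj_eq einj) neq_ltn k0k orbT.
exists N => k /NP kX; rewrite inE negb_or kX andbT.
by apply/eqP => ek; apply: noe; exists k.
Qed.

(* The relation between the values of two conjugate functions, each supported
   on a single point of the orbit of [s]. *)
Definition compatible b s (a a' : A) : Prop :=
  a = a' \/ finite_set (cyclic_orbit to b s) /\ exists x, a ^ x = a'.

Lemma compatible_sym b s a a' : compatible b s a a' -> compatible b s a' a.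
Proof.
case=> [->|[fO [x xa]]]; [by left | right; split=> //].
by exists x^-1; rewrite -xa conjgK.
Qed.

Lemma finite_cyclic_orbit_act b c s : commute c b ->
  finite_set (cyclic_orbit to b s) -> finite_set (cyclic_orbit to b (to s c)).
Proof.
move=> cb /(finite_image (to^~ c)); apply: sub_finite_set => t st.
exists (to t c^-1); last by rewrite ractKV.
by rewrite -(cyclic_orbit_commute _ _ _ cb) ractKV.
Qed.

Lemma compatible_act b c s a a' : commute c b ->
  compatible b (to s c) a a' <-> compatible b s a a'.
Proof.
move=> cb; split=> -[->|[fO aa']]; try by left.
  right; split=> //; rewrite -[s](ractK to c);
    apply: finite_cyclic_orbit_act => //.
  exact/commute_sym/commuteV/commute_sym.
by right; split=> //; exact: finite_cyclic_orbit_act.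
Qed.

Lemma base_conj_compatible b f f' s t :
  base_conj b f f' -> orbit b s t ->
  (forall u, orbit b s u -> u != s -> f u = 1) ->
  (forall u, orbit b s u -> u != t -> f' u = 1) ->
  compatible b s (f s) (f' t).
Proof.
case=> g gP st f1 f'1.
(* The product along a window of the orbit reduces to its only nontrivial
   factor. The window is a full period if the orbit is finite; otherwise it is
   chosen so long that [g] is trivial at both ends. *)
have window y n i i' : (forall k, (0 < k < n)%N -> to y (b ^+ k) <> y) ->
    (i < n)%N -> (i' < n)%N -> s = to y (b ^+ i.+1) -> t = to y (b ^+ i'.+1) ->
    f' t = (g y)^-1 * f s * g (to y (b ^+ n)).
  move=> yn iN i'N sE tE.
  have ys : orbit b s y by rewrite sE; exact/cyclic_orbit_sym/cyclic_orbitX.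
  have inj j j' : (j < n)%N -> (j' < n)%N -> j != j' ->
      to y (b ^+ j.+1) != to y (b ^+ j'.+1).
    move=> jn j'n; apply: contra => /eqP /(congr1 (to^~ b^-1)).
    by rewrite !expgSr !ractM !ractK => /(ractX_inj yn jn j'n) ->.
  have -> : f s = \prod_(j < n) f (to y (b ^+ j.+1)).
    rewrite (@prod_single n (fun j => f (to y (b ^+ j.+1))) i) -?sE // => j jn
      ji.
    by apply: f1; [exact: cyclic_orbit_trans ys (cyclic_orbitX _ _ _ _) |
      rewrite sE inj].
  rewrite -(base_conj_prod _ _ gP).
  rewrite (@prod_single n (fun j => f' (to y (b ^+ j.+1))) i') -?tE // => j jn
    ji.
  by apply: f'1; [exact: cyclic_orbit_trans ys (cyclic_orbitX _ _ _ _) |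
    rewrite tE inj].
have [per|noper] := pselect (exists n, (0 < n)%N && (to s (b ^+ n) == s)).
  case: (ex_minnP per) => n /andP[n0 /eqP sn] nmin.
  right; split; first exact: finite_cyclic_orbit n0 sn.
  (* Windows use the exponents from 1 to [n], so it is the predecessor of [t] that is located at an
     exponent below [n]. *)
  have tb : orbit b s (to t b^-1).
    exact: cyclic_orbit_trans st (cyclic_orbitV _ _ _).
  have [i' i'n tE] := cyclic_orbit_period n0 sn tb.
  (* The window of one full period from [s] has [s] at both ends, so both boundary factors come from
     [g s] and form a conjugation. *)
  exists (g s); rewrite conjgE mulgA -{3}sn; apply/esym.
  apply: (window s n n.-1 i') => //; rewrite ?prednK //.
  - move=> k /andP[k0 kn] /eqP sk.
    by have := nmin k; rewrite k0 sk /= => /(_ isT); rewrite leqNgt kn.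
  - by rewrite expgSr ractM -tE ractKV.
left.
have noperc k c : commute c b -> (0 < k)%N -> to (to s c) (b ^+ k) <> to s c.
  move=> cb k0; rewrite -ractM (commuteX k cb) ractM => /(congr1 (to^~ c^-1)).
  by rewrite !ractK => sk; apply: noper; exists k; rewrite k0 sk eqxx.
have inj (e : B) : commute e b -> (forall k, (0 < k)%N -> to s (e ^+ k) <> s) ->
    injective (fun k => to s (e ^+ k)).
  move=> eb se i j; apply: (@ractX_inj _ _ (maxn i j).+1).
  - by move=> k /andP[k0 _]; exact: se.
  - by rewrite ltnS leq_maxl.
  - by rewrite ltnS leq_maxr.
have nob k : (0 < k)%N -> to s (b ^+ k) <> s.
  by move=> k0; have := noperc k 1 (commute_sym (commute1 b)) k0; rewrite ract1.
have nobV k : (0 < k)%N -> to s (b^-1 ^+ k) <> s.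
  move=> k0; rewrite expVgn => /(congr1 (to^~ (b ^+ k))).
  by rewrite ractKV => /esym; exact: nob.
have [N1 gN1] := finsupp_escape g (inj b (commute_refl b) nob).
have [N2 gN2] :=
  finsupp_escape g (inj b^-1 (commute_sym (commuteV (commute_refl b))) nobV).
case: st => c [d cE] tE.
(* Exceeding [N1] and [N2] makes [g] trivial at [s b^N] and [s b^-N]; exceeding [d] puts [t], which
   is [s b^d] or [s b^-d], at an exponent from 1 to [2N] counted from [s b^-N]. *)
pose N := (maxn N1 N2 + d).+1.
have dN : (d < N)%N by rewrite ltnS leq_addl.
pose y := to s (b ^- N).
have yN : to y (b ^+ N) = s by rewrite ractKV.
have NN : (N.-1 < N + N)%N by rewrite prednK // leq_addr.
have y1 : g y = 1.
  rewrite /y -expVgn; apply: gN2.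
  by apply/leqW/(leq_trans (leq_maxr N1 N2))/leq_addr.
have yNN : g (to y (b ^+ (N + N))) = 1.
  rewrite expgnDr ractM yN; apply: gN1.
  by apply/leqW/(leq_trans (leq_maxl N1 N2))/leq_addr.
have yno k : (0 < k < N + N)%N -> to y (b ^+ k) <> y.
  case/andP=> k0 _; apply: noperc => //.
  exact/commute_sym/commuteV/commuteX/commute_refl.
have [i iN tyi] : exists2 i, (i < N + N)%N & t = to y (b ^+ i.+1).
  case: cE tE => -> <-.
    exists (N + d).-1; rewrite prednK ?ltn_add2l ?addSn //.
      by rewrite -addSn ltnW // ltn_add2l.
    by rewrite -addSn expgnDr ractM yN.
  exists (N - d).-1; rewrite prednK ?subn_gt0 //.
    by rewrite (leq_trans (leq_subr _ _)) // leq_addr.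
  by rewrite expgnFr ?(ltnW dN) // ractM yN.
have := window y _ _ _ yno NN iN _ tyi; rewrite y1 yNN prednK // yN.
by rewrite invg1 mul1g mulg1 => /(_ erefl) ->.
Qed.

(** * Functions given by lists, and their normal forms *)

Implicit Types (P Q : seq (A * S)) (p q : A * S).

(** An ordered product: the lists read off from words may repeat a point, and [A] need not be
    abelian. *)
Definition base_prod P : base :=
  foldr (fun p => base_mul (base_delta p.1 p.2)) base1 P.

Lemma base_prodE P s : base_prod P s = \prod_(p <- P | p.2 == s) p.1.
Proof.
elim: P => [|p P IH]; first by rewrite fsfunE big_nil.
by rewrite base_mulE base_deltaE big_cons IH eq_sym; case: eqP; rewrite ?mul1g.
Qed.

Lemma base_prod_finsupp f : base_prod [seq (f s, s) | s <- finsupp f] = f.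
Proof.
apply/fsfunP => s; rewrite base_prodE big_map.
have [sf|sf] := boolP (s \in finsupp f).
  rewrite -big_filter (_ : [seq _ <- _ | _] = [:: s]) ?big_seq1 //.
  exact: filter_pred1_uniq (fset_uniq _) sf.
rewrite (fsfun_dflt sf) big1_seq // => t /andP[/eqP ts tf].
by rewrite -ts tf in sf.
Qed.

Definition distinct_orbits b P : bool :=
  pairwise (fun p q => `[< ~ orbit b p.2 q.2 >]) P.

(** The concentrated functions. Excluding the value 1 forces each entry to have a partner in every
    conjugate normal list. *)
Definition normal b P : bool :=
  distinct_orbits b P && all (fun p => p.1 != 1) P.

Lemma pairwise_orbits_eq (I : eqType) (f : I -> S) b (s : seq I) x y :
  pairwise (fun x y => `[< ~ orbit b (f x) (f y) >]) s ->
  x \in s -> y \in s -> orbit b (f x) (f y) -> x = y.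
Proof.
move=> ds xs ys xy.
have /or3P[/eqP//|/asboolP[]//|/asboolP[]] := pairwise_mem ds xs ys.
exact: cyclic_orbit_sym.
Qed.

Lemma distinct_orbits_eq b P p q :
  distinct_orbits b P -> p \in P -> q \in P -> orbit b p.2 q.2 -> p = q.
Proof. exact: pairwise_orbits_eq. Qed.

Lemma base_prod_in b P p : distinct_orbits b P -> p \in P -> base_prod P p.2 =
  p.1.
Proof.
elim: P => [//|q P IH] /= /andP[/allP qP dP].
rewrite base_mulE base_deltaE inE.
have off r : r \in P -> r.2 != q.2.
  move=> rP; apply/eqP => rq; have /asboolP[] := qP _ rP.
  by rewrite rq; exact: cyclic_orbit_refl.
case/orP=> [/eqP->|pP]; last by rewrite (negPf (off _ pP)) mul1g IH.
by rewrite eqxx base_prodE big1_seq ?mulg1 // => r /andP[/eqP rq /off];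
  rewrite rq eqxx.
Qed.

Lemma base_prod_notin P s : {in P, forall p, p.2 != s} -> base_prod P s = 1.
Proof.
by move=> Ps; rewrite base_prodE big1_seq // => p /andP[ps /Ps]; rewrite ps.
Qed.

Lemma eq_base_prod b P Q :
  distinct_orbits b P -> distinct_orbits b Q -> P =i Q -> base_prod P =
    base_prod Q.
Proof.
move=> dP dQ PQ; apply/fsfunP => s.
have [[p pP <-]|noP] := pselect (exists2 p, p \in P & p.2 = s).
  by rewrite (base_prod_in dP pP) (base_prod_in dQ) // -PQ.
have notP p : p \in P -> p.2 != s.
  by move=> pP; apply/eqP => ps; apply: noP; exists p.
by rewrite !base_prod_notin // => p; rewrite -PQ; exact: notP.
Qed.

Definition linked b p q : Prop := orbit b p.2 q.2 /\ compatible b p.2 p.1 q.1.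

(** The entries are replaced one at a time: the value is changed at the old point, then moved along
    its orbit. The accumulator [f] collects finished entries, and stays trivial on the orbits still
    to be treated. *)
Lemma base_conj_linked b P Q f :
  distinct_orbits b P -> size P = size Q ->
  (forall r, r \in zip P Q -> linked b r.1 r.2) ->
  (forall p s, p \in P -> orbit b p.2 s -> f s = 1) ->
  base_conj b (base_mul f (base_prod P)) (base_mul f (base_prod Q)).
Proof.
elim: P Q f => [|p P IH] [|q Q] f //=; first by move=> _ _ _ _;
  exact: base_conj_refl.
case/andP=> /allP pP dP [szPQ] lPQ fP.
have [pq cpq] : linked b p q by apply: (lPQ (p, q)); exact: mem_head.
pose h := base_mul f (base_prod P).
have h1 s : orbit b p.2 s -> h s = 1.
  move=> ps; rewrite base_mulE (fP p) ?mem_head // mul1g base_prod_notin // =>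
    r rP.
  by apply/eqP => rs; have /asboolP[] := pP _ rP; rewrite rs.
(* Since [f] and the remaining entries are trivial on this orbit, the factor at [r] can be written
   last, as the moving lemmas require. *)
have hE (r : A * S) : orbit b p.2 r.2 ->
    base_mul f (base_mul (base_delta r.1 r.2) (base_prod P)) =
    base_mul h (base_delta r.1 r.2).
  move=> pr; apply/fsfunP => s; rewrite !base_mulE base_deltaE.
  case: eqP => [->|_]; last by rewrite mul1g mulg1.
  have := h1 _ pr; rewrite base_mulE => fP1; rewrite fP1 mul1g.
  have f1 : f r.2 = 1 by apply: fP pr; exact: mem_head.
  by move: fP1; rewrite f1 !mul1g => ->; rewrite mulg1.
apply: (@base_conj_trans _ _ (base_mul f (base_mul (base_delta q.1 q.2)
  (base_prod P)))).
  rewrite (hE p) ?(hE q) //; last exact: cyclic_orbit_refl.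
  apply: (@base_conj_trans _ _ (base_mul h (base_delta q.1 p.2))); last first.
    exact: base_conj_move.
  case: cpq => [->|[fO [x <-]]]; first exact: base_conj_refl.
  exact: base_conj_finite.
have mulA (u v w : base) : base_mul u (base_mul v w) = base_mul (base_mul u v)
  w.
  by apply/fsfunP => s; rewrite !base_mulE mulgA.
rewrite !mulA; apply: IH => // [r rPQ|r s rP rs].
  by apply: lPQ; rewrite inE rPQ orbT.
rewrite base_mulE base_deltaE (fP r) ?mul1g //; last by rewrite inE rP orbT.
case: eqP => // sq; have /asboolP[] := pP _ rP.
by apply: cyclic_orbit_trans pq _; rewrite -sq; exact: cyclic_orbit_sym.
Qed.

(** If [Q] had no entry in the orbit of [p], its function would be trivial there, so [p.1] would be
    compatible with 1 and hence equal to 1. If it has one, the two values are compatible. *)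
Lemma base_conj_mem_linked b P Q :
  normal b P -> normal b Q -> base_conj b (base_prod P) (base_prod Q) ->
  {in P, forall p, exists2 q, q \in Q & linked b p q}.
Proof.
case/andP=> dP /allP P1 /andP[dQ _] cPQ p pP.
have sP u : orbit b p.2 u -> u != p.2 -> base_prod P u = 1.
  move=> pu up; apply: base_prod_notin => r rP; apply/eqP => ru.
  by move: up; rewrite -ru (distinct_orbits_eq dP pP rP) ?eqxx // ru.
have [[q qQ pq]|noQ] := pselect (exists2 q, q \in Q & orbit b p.2 q.2).
  exists q => //; split=> //.
  rewrite -(base_prod_in dP pP) -(base_prod_in dQ qQ).
  apply: (base_conj_compatible cPQ pq sP) => u pu uq.
  apply: base_prod_notin => r rQ; apply/eqP => ru; move: uq; rewrite -ru.
  rewrite (distinct_orbits_eq dQ qQ rQ) ?eqxx // ru.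
  exact: cyclic_orbit_trans (cyclic_orbit_sym pq) pu.
have Q1 u : orbit b p.2 u -> base_prod Q u = 1.
  move=> pu; apply: base_prod_notin => r rQ; apply/eqP => ru.
  by apply: noQ; exists r; rewrite ?ru.
have := base_conj_compatible cPQ (cyclic_orbit_refl _ _ _) sP (fun u pu _ => Q1
  u pu).
rewrite (base_prod_in dP pP) Q1; last exact: cyclic_orbit_refl.
move/eqP: (P1 _ pP) => p1.
case=> [//|[_ [x /eqP]]]; rewrite conjg_eq1 => /eqP //.
Qed.

Lemma base_prod_act P c :
  base_act to (base_prod P) c = base_prod [seq (p.1, to p.2 c) | p <- P].
Proof.
apply/fsfunP => s; rewrite base_actE !base_prodE big_map.
apply: eq_bigl => p /=; apply/eqP/eqP => [->|<-]; last by rewrite ractK.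
by rewrite ractKV.
Qed.

Lemma normal_act b c P :
  commute c b -> normal b [seq (p.1, to p.2 c) | p <- P] = normal b P.
Proof.
move=> cb; rewrite /normal /distinct_orbits pairwise_map all_map;
  congr (_ && _).
apply: eq_pairwise => p q /=; apply: asbool_equiv_eq.
by rewrite cyclic_orbit_commute.
Qed.

(** The value at [s] is pushed to the next point. If [f] was nontrivial there, [s] leaves the
    support and nothing enters; otherwise the support does not grow and the gap [k] drops by one. *)
Lemma base_conj_merge b f s k :
  f s != 1 -> f (to s (b ^+ k)) != 1 -> to s (b ^+ k) != s ->
  exists2 f', base_conj b f f' & (#|` finsupp f' | < #|` finsupp f |)%N.
Proof.
elim: k f s => [|k IH] f s fs; first by rewrite ract1 eqxx.
rewrite expgS ractM => ft ts.
have [sbs|sbs] := eqVneq (to s b) s.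
  by move: ft ts; rewrite sbs; exact: IH.
pose X := (finsupp f `|` [fset to s b])%fset.
pose f' : base := [fsfun t in X => if t == s then 1
  else if t == to s b then f s * f (to s b) else f t | 1].
have f'E t : f' t = if t == s then 1
    else if t == to s b then f s * f (to s b) else f t.
  rewrite fsfunE !inE; case: ifP => // /negbT; rewrite negb_or.
  by case/andP=> tf /negPf ->; rewrite (fsfun_dflt tf); case: eqP.
have ff' : base_conj b f f' by exact: base_conj_push f'E.
have supp t : f' t != 1 -> t != s /\ (t == to s b) || (f t != 1).
  by rewrite f'E; case: (t == s); case: (t == to s b); rewrite ?eqxx.
have sf : s \in finsupp f by rewrite mem_finsupp.
have [fsb|fsb] := eqVneq (f (to s b)) 1.
  have tsb : to (to s b) (b ^+ k) != to s b.
    by apply: contraNneq ft => ->; rewrite fsb.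
  have [f'' f'f'' card] : exists2 f'', base_conj b f' f'' &
      (#|` finsupp f'' | < #|` finsupp f' |)%N.
    apply: (IH _ (to s b)) => //; rewrite f'E.
      by rewrite (negPf sbs) eqxx fsb mulg1.
    by rewrite (negPf ts) (negPf tsb).
  exists f''; first exact: base_conj_trans ff' f'f''.
  apply: leq_trans card _.
  apply: (@leq_trans #|` (to s b |` (finsupp f `\ s))%fset |).
    apply/fsubset_leq_card/fsubsetP => t; rewrite mem_finsupp => /supp[ts' tP].
    by rewrite !inE ts' mem_finsupp.
  rewrite cardfsU1 (cardfsD1 s (finsupp f)) sf leq_add2r.
  by case: (_ \notin _).
exists f' => //; rewrite (cardfsD1 s (finsupp f)) sf add1n ltnS.
apply/fsubset_leq_card/fsubsetP => t; rewrite mem_finsupp => /supp[ts' tP].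
by rewrite !inE ts' mem_finsupp; case/orP: tP => [/eqP->|].
Qed.

(** By induction on the size of the support: points in a common orbit are merged, and when no merge
    remains the support itself lists a normal form. *)
Lemma normal_form b f : exists2 P, normal b P & base_conj b f (base_prod P).
Proof.
have [n] := ubnP #|` finsupp f |; elim: n f => // n IH f fn.
have [[s [k [fs ft ts]]]|nomerge] := pselect (exists s k,
    [/\ f s != 1, f (to s (b ^+ k)) != 1 & to s (b ^+ k) != s]).
  have [f' ff' card] := base_conj_merge fs ft ts.
  have [|P nP f'P] := IH f'; first exact: leq_trans card _.
  by exists P => //; exact: base_conj_trans ff' f'P.
have single s t : f s != 1 -> f t != 1 -> orbit b s t -> s = t.
  move=> fs ft [c [k ck] tE]; apply/eqP; apply: contrapT => /negP st;
    apply: nomerge.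
  case: ck tE => -> tE; first by exists s, k; rewrite tE; split;
    rewrite // eq_sym.
  by exists t, k; rewrite -{2 3}tE ractKV.
pose P := [seq (f s, s) | s <- finsupp f].
have dP : distinct_orbits b P.
  rewrite /distinct_orbits pairwise_map.
  have := fset_uniq (finsupp f); rewrite uniq_pairwise.
  apply: sub_in_pairwise (allss _) => s t sf tf /= st.
  apply/asboolP => /single stE; move: st; rewrite stE ?eqxx // -mem_finsupp //.
exists P.
  rewrite /normal dP all_map; apply/allP => s; by rewrite /= mem_finsupp.
by rewrite base_prod_finsupp; exact: base_conj_refl.
Qed.


(** The combinatorial criterion used in both directions of the theorem. Indexing by [I] lets
    matchings be lists of words instead of group elements. Equality of members suffices for
    [unzip2 z] and [Q], because orbits within each list are distinct. *)
Lemma wreath_conj_normal (I : eqType) (pt : I -> A * S) b (P Q : seq I) :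
  normal b (map pt P) -> normal b (map pt Q) ->
  (exists z, ((b, base_prod (map pt P)) : wreath A to) ^ z =
             ((b, base_prod (map pt Q)) : wreath A to)) <->
  exists c z, [/\ commute c b, unzip1 z = P, unzip2 z =i Q &
    {in z, forall x, linked b ((pt x.1).1, to (pt x.1).2 c) (pt x.2)}].
Proof.
move=> nP nQ; pose ptc c (p : I) := ((pt p).1, to (pt p).2 c).
have actE c : base_act to (base_prod (map pt P)) c = base_prod (map (ptc c) P).
  by rewrite base_prod_act -map_comp.
have nPc c : commute c b -> normal b (map (ptc c) P).
  by move=> cb; move: nP; rewrite -(normal_act (map pt P) cb) -map_comp.
have dI (s : seq I) x y : normal b (map pt s) -> x \in s -> y \in s ->
    orbit b (pt x).2 (pt y).2 -> x = y.
  by case/andP=> + _; rewrite /distinct_orbits pairwise_map;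
    exact: pairwise_orbits_eq.
split=> [/wreath_conjP[c /= cb]|[c [z [cb zP zQ lz]]]].
  rewrite actE => conj.
  have {}cb : commute c b by exact/commute_sym.
  have match_PQ := base_conj_mem_linked (nPc _ cb) nQ conj.
  have match_QP := base_conj_mem_linked nQ (nPc _ cb) (base_conj_sym conj).
  have [|z [zP zQ lz]] := @choose_partners _ _ P Q
      (fun x y => linked b (ptc c x) (pt y)).
    move=> x xP; have [|_ /mapP[y yQ ->] l] := match_PQ (ptc c x).
      exact: map_f.
    by exists y.
  exists c, z; split=> // y; apply/idP/idP => [/zQ //|yQ].
  (* Every [y] in [Q] is attained: its partner in [P] is matched with some [w.2] in the orbit of
     [y], and [Q] has at most one entry per orbit. *)
  have [|_ /mapP[x xP ->] l] := match_QP (pt y); first exact: map_f.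
  move: xP; rewrite -zP => /mapP[w wz xE].
  suff -> : y = w.2 by exact: map_f.
  apply: (dI Q) => //; first by apply: zQ; exact: map_f.
  apply: cyclic_orbit_trans l.1 _; rewrite xE; exact: (lz _ wz).1.
apply/wreath_conjP; exists c; first exact/commute_sym.
rewrite /= actE.
(* The matched entries inherit distinct orbits from [P] moved by [c], so [unzip2 z] can be replaced
   by [Q]. *)
have dz : distinct_orbits b (map pt (unzip2 z)).
  have /andP[+ _] := nPc _ cb.
  rewrite /distinct_orbits -zP -!map_comp !pairwise_map.
  apply: sub_in_pairwise (allss z) => x y xz yz /= /asboolP nxy.
  apply/asboolP => xy; apply: nxy; apply: cyclic_orbit_trans (lz _ xz).1 _.
  exact: cyclic_orbit_trans xy (cyclic_orbit_sym (lz _ yz).1).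
have <- : base_prod (map pt (unzip2 z)) = base_prod (map pt Q).
  apply: eq_base_prod dz _ _; first by case/andP: nQ.
  exact: eq_mem_map.
have mul1 f : base_mul base1 f = f.
  by apply/fsfunP => s; rewrite base_mulE fsfunE mul1g.
rewrite -[X in base_conj _ X]mul1 -[X in base_conj _ _ X]mul1.
apply: base_conj_linked => [||x|p s _ _]; last by rewrite fsfunE.
- by case/andP: (nPc _ cb).
- by rewrite -zP !size_map.
- rewrite -zP -!map_comp zip_map => /mapP[y yz ->]; exact: lz.
Qed.

(** The value [a] is pushed along the orbit until it meets [a^-1]. For a negative power the roles of
    the two values are exchanged. *)
Lemma base_conj_cancel b s t a : orbit b s t ->
  base_conj b (base_prod [:: (a, s); (a^-1, t)]) base1.
Proof.
have prodE a' s' t' u : base_prod [:: (a', s'); (a'^-1, t')] u =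
    (if u == s' then a' else 1) * (if u == t' then a'^-1 else 1).
  by rewrite /= !base_mulE !base_deltaE fsfunE mulg1.
have prod1 a' s' : base_prod [:: (a', s'); (a'^-1, s')] = base1.
  apply/fsfunP => u; rewrite prodE fsfunE.
  by case: eqP; rewrite ?mulgV ?mulg1.
have up a' s' k : base_conj b (base_prod [:: (a', s');
  (a'^-1, to s' (b ^+ k))]) base1.
  elim: k s' => [|k IH] s'; first by rewrite ract1 prod1; exact: base_conj_refl.
  rewrite expgS ractM.
  have [->|sbs] := eqVneq (to s' b) s'; first exact: IH.
  have [->|ts] := eqVneq (to (to s' b) (b ^+ k)) s'.
    by rewrite prod1; exact: base_conj_refl.
  apply: base_conj_trans (IH (to s' b)); apply: (base_conj_push sbs) => u.
  rewrite !prodE eqxx (eq_sym s') (negPf ts) mulg1 (negPf sbs) mul1g.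
  have [->|us] := eqVneq u s'.
    by rewrite !(eq_sym s') (negPf sbs) (negPf ts) mulg1.
  by case: (u =P to s' b) => [->|_].
case=> _ [k [] ->] <-; first exact: up.
have -> : base_prod [:: (a, s); (a^-1, to s (b ^- k))] =
    base_prod [:: (a^-1, to s (b ^- k)); (a^-1^-1, s)].
  have [st|st] := eqVneq s (to s (b ^- k)); first by rewrite -st prod1 prod1.
  apply/fsfunP => u; rewrite !prodE.
  by case: (u =P s) => [->|_]; rewrite ?(negPf st) ?invgK mulg1 mul1g.
by rewrite -{2}[s](ractKV to (b ^+ k)); exact: up.
Qed.

End BaseConjugacy.

(** * Words *)

Section WordEval.

Context {I : countType} {G : groupType} (g : I -> G).

Definition word_inv (w : word I) : word I := rev [seq (l.1, ~~ l.2) | l <- w].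

Lemma word_eval_nil : word_eval g [::] = 1.
Proof. exact: big_nil. Qed.

Lemma word_eval_cat u v : word_eval g (u ++ v) = word_eval g u * word_eval g v.
Proof. exact: big_cat. Qed.

Lemma word_eval_cons l w :
  word_eval g (l :: w) = (if l.2 then (g l.1)^-1 else g l.1) * word_eval g w.
Proof. exact: big_cons. Qed.

Lemma word_eval_inv w : word_eval g (word_inv w) = (word_eval g w)^-1.
Proof.
elim: w => [|[i e] w IH]; first by rewrite word_eval_nil invg1.
rewrite /word_inv map_cons rev_cons -cats1 word_eval_cat IH !word_eval_cons.
by rewrite word_eval_nil mulg1 invgM; case: e; rewrite ?invgK.
Qed.

Lemma word_eval_flatten (ws : seq (word I)) :
  word_eval g (flatten ws) = \prod_(w <- ws) word_eval g w.
Proof.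
elim: ws => [|w ws IH]; first by rewrite big_nil -word_eval_nil.
by rewrite big_cons -IH -word_eval_cat.
Qed.

End WordEval.

Lemma word_eval_map (I J : countType) (G : groupType) (g : J -> G) (f : I -> J)
    (w : word I) :
  word_eval g [seq (f l.1, l.2) | l <- w] = word_eval (g \o f) w.
Proof. by rewrite /word_eval big_map. Qed.

Section Words.

Context {A B : groupType} {S : choiceType} (to : right_action B S) (s0 : S).
Context {p q : nat} (gA : 'I_p -> A) (gB : 'I_q -> B).

Local Notation evA := (word_eval gA).
Local Notation evB := (word_eval gB).
Local Notation gens := (wreath_gens to gA gB s0).
Local Notation wordA := (word 'I_p).
Local Notation wordB := (word 'I_q).
Local Notation wordW := (word ('I_q + 'I_p)%type).
Local Notation base1 := ([fsfun of _ => 1] : {fsfun S -> A with 1}).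
Local Notation wr b f := ((b, f) : wreath A to).

Definition point (x : wordA * wordB) : A * S := (evA x.1, to s0 (evB x.2)).

(* A generator of [B] contributes the trivial value [::] of [A] to [parts]. *)
Definition letterA (l : ('I_q + 'I_p) * bool) : wordA :=
  if l.1 is inr i then [:: (i, l.2)] else [::].

Definition letterB (l : ('I_q + 'I_p) * bool) : wordB :=
  if l.1 is inl j then [:: (j, l.2)] else [::].

(** Moving a letter of [A] to the right past the rest of the word carries its point from [s0] to the
    image of [s0] under the [B]-part of that rest, which is [x.1]. *)
Definition parts (u : wordW) : wordB * seq (wordA * wordB) :=
  foldr (fun l x => (letterB l ++ x.1, (letterA l, x.1) :: x.2)) ([::], [::]) u.

Definition wordWB (w : wordB) : wordW := [seq (inl l.1, l.2) | l <- w].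

Definition wordWA (w : wordA) : wordW := [seq (inr l.1, l.2) | l <- w].

(** A value at [s0], conjugated by a word of [B], becomes the same value at the translated point. *)
Definition wreath_word (x : wordB * seq (wordA * wordB)) : wordW :=
  wordWB x.1 ++ flatten
    [seq word_inv (wordWB y.2) ++ wordWA y.1 ++ wordWB y.2 | y <- x.2].

Lemma wreathM b c f g :
  wr b f * wr c g = wr (b * c) (base_mul (base_act to f c) g).
Proof. by []. Qed.

Lemma base_mul1 (f : {fsfun S -> A with 1}) : base_mul f base1 = f.
Proof. by apply/fsfunP => s; rewrite base_mulE fsfunE mulg1. Qed.

Lemma base_1mul (f : {fsfun S -> A with 1}) : base_mul base1 f = f.
Proof. by apply/fsfunP => s; rewrite base_mulE fsfunE mul1g. Qed.

Lemma base_act1 (f : {fsfun S -> A with 1}) : base_act to f 1 = f.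
Proof. by apply/fsfunP => s; rewrite base_actE invg1 ract1. Qed.

Lemma base_1act c : base_act to base1 c = base1.
Proof. by apply/fsfunP => s; rewrite base_actE !fsfunE. Qed.

Lemma wreath_invB b : (wr b base1)^-1 = wr b^-1 base1.
Proof.
apply: (mulgI (wr b base1)); rewrite mulgV wreathM mulgV base_1act.
by rewrite base_mul1.
Qed.

Lemma wreath_invA a s : (wr 1 (base_delta a s))^-1 = wr 1 (base_delta a^-1 s).
Proof.
apply: (mulgI (wr 1 (base_delta a s))); rewrite mulgV wreathM mulg1 base_act1.
congr pair; apply/fsfunP => t; rewrite base_mulE !base_deltaE fsfunE.
by case: eqP; rewrite ?mulgV ?mulg1.
Qed.

Lemma word_evalWB w : word_eval gens (wordWB w) = wr (evB w) base1.
Proof.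
rewrite word_eval_map; elim: w => [|[i e] w IH];
  first by rewrite !word_eval_nil.
rewrite !word_eval_cons IH /=.
by case: e; rewrite ?wreath_invB wreathM base_1act base_mul1.
Qed.

Lemma word_evalWA w : word_eval gens (wordWA w) = wr 1 (base_delta (evA w) s0).
Proof.
rewrite word_eval_map; elim: w => [|[i e] w IH].
  rewrite !word_eval_nil; congr pair; apply/fsfunP => t.
  by rewrite base_deltaE fsfunE if_same.
rewrite !word_eval_cons IH /=.
case: e; rewrite ?wreath_invA wreathM mulg1 base_act1; congr pair;
  by apply/fsfunP => t; rewrite base_mulE !base_deltaE; case: eqP;
    rewrite ?mulg1.
Qed.

Lemma base_act_delta (a : A) s c : base_act to (base_delta a s) c = base_delta
  a (to s c).
Proof.
apply/fsfunP => t; rewrite base_actE !base_deltaE; congr (if _ then _ else _).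
by apply/eqP/eqP => [<-|->]; rewrite ?ractK ?ractKV.
Qed.

Lemma word_eval_parts u :
  word_eval gens u = wr (evB (parts u).1) (base_prod (map point (parts u).2)).
Proof.
elim: u => [|[[j|i] e] u IH]; first by rewrite /= !word_eval_nil.
  rewrite word_eval_cons IH /= word_eval_cons; set F := base_prod _.
  have -> : base_mul (base_delta (evA [::]) (to s0 (evB (parts u).1))) F = F.
    apply/fsfunP => s.
    by rewrite base_mulE base_deltaE word_eval_nil if_same mul1g.
  by case: e; rewrite ?wreath_invB wreathM base_1act base_1mul.
rewrite word_eval_cons IH /= word_eval_cons word_eval_nil mulg1 /=.
by case: e; rewrite ?wreath_invA wreathM mul1g base_act_delta.
Qed.

Lemma word_eval_wreath x :
  word_eval gens (wreath_word x) = wr (evB x.1) (base_prod (map point x.2)).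
Proof.
case: x => b L; rewrite word_eval_cat word_evalWB /= word_eval_flatten.
suff -> : \prod_(w <- [seq word_inv (wordWB y.2) ++ wordWA y.1 ++ wordWB y.2 |
  y <- L])
    word_eval gens w = wr 1 (base_prod (map point L)).
  by rewrite wreathM mulg1 base_1act base_1mul.
elim: L => [|[a t] L IH]; first by rewrite big_nil.
rewrite big_cons IH /= !word_eval_cat word_eval_inv word_evalWB word_evalWA.
rewrite wreath_invB !wreathM !mul1g mulVg base_1act base_1mul base_act_delta.
by rewrite /= base_mul1 base_act1 mulg1.
Qed.

Lemma cyclic_orbit1 s t : cyclic_orbit to 1 s t <-> s = t.
Proof.
split=> [[c [k [] ->]]|->]; last exact: cyclic_orbit_refl.
  by rewrite expg1n ract1.
by rewrite expg1n invg1 ract1.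
Qed.

(** Cosets of [H] are points of [S], so a double coset becomes an orbit; this is how condition (iii)
    is used. *)
Lemma stab_cyclicP b c d :
  stab_cyclic to s0 c b d <-> cyclic_orbit to b (to s0 c) (to s0 d).
Proof.
split=> [[h hs [e be <-]]|[e be cd]].
  by exists e => //; rewrite -ractM -mulgA [RHS]ractM hs.
exists (d * (c * e)^-1); last by exists e => //; rewrite -!mulgA mulVg mulg1.
by rewrite /stabiliser /= ractM -cd -!ractM mulgA mulgV ract1.
Qed.

(** An element of the intersection is a [c] in the centraliser whose product [alpha_i * c] lies in
    each double coset. *)
Lemma intersectionP b (ps : seq (wordB * wordB)) :
  ((\bigcap_(x in [set` ps])
     [set (evB x.1)^-1 * y | y in stab_cyclic to s0 (evB x.2) b])
   `&` centraliser b = set0)%classic <->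
  ~ exists2 c, commute c b & {in ps, forall x,
      cyclic_orbit to b (to s0 (evB x.1 * c)) (to s0 (evB x.2))}.
Proof.
split=> [e [c cb cps]|no].
  suff : (set0 : set B) c by [].
  rewrite -e; split=> // x xps; exists (evB x.1 * c); last by rewrite mulKg.
  exact/stab_cyclicP/cyclic_orbit_sym/cps.
apply/seteqP; split=> // c [cps cb]; apply: no; exists c => // x xps.
have [y /stab_cyclicP xy <-] := cps x xps; rewrite mulVKg.
exact: cyclic_orbit_sym.
Qed.

Section Generation.

Context (genA : forall x : A, exists w, evA w = x).
Context (genB : forall x : B, exists w, evB w = x).
Context (to_trans : transitive_action to).

Lemma point_surj (P : seq (A * S)) : exists L, map point L = P.
Proof.
elim: P => [|[a s] P [L LP]]; first by exists [::].
have [b bs] := to_trans s0 s; have [w wa] := genA a; have [t tb] := genB b.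
by exists ((w, t) :: L); rewrite /= LP /point /= wa tb bs.
Qed.

Lemma wreath_word_surj (z : wreath A to) : exists w, word_eval gens w = z.
Proof.
case: z => b f; have [t tb] := genB b.
have [L LP] := point_surj [seq (f s, s) | s <- finsupp f].
by exists (wreath_word (t, L));
  rewrite word_eval_wreath LP base_prod_finsupp tb.
Qed.

End Generation.

End Words.

(** * Computability of the operations on words *)

Section WordComputable.

Context {p q : nat}.

Local Notation wordA := (word 'I_p).
Local Notation wordB := (word 'I_q).
Local Notation wordW := (word ('I_q + 'I_p)%type).

Lemma computable_relabel (I J : finType) (T : countType) (h : I -> J)
    (f : T -> word I) :
  computable f -> computable (fun x => [seq (h l.1, l.2) | l <- f x] : word J).
Proof.
move=> cf; apply: computable_map => //.
apply: (@computable_finType (I * bool)%type _ _ (fun l => (h l.1, l.2))).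
by computability.
Qed.

Lemma computable_word_inv (I : finType) (T : countType) (f : T -> word I) :
  computable f -> computable (fun x => word_inv (f x)).
Proof.
move=> cf; apply: computable_rev; apply: computable_map => //.
apply: (@computable_finType (I * bool)%type _ _ (fun l => (l.1, ~~ l.2))).
by computability.
Qed.

Lemma effective_word (I : finType) : effective (word I).
Proof. exact: effective_seq (@effective_fin (I * bool)%type). Qed.

Lemma computable_parts (T : countType) (f : T -> wordW) :
  computable f -> computable (fun x => parts (f x)).
Proof.
move=> cf; rewrite /parts; computability => //; apply: computable_finType;
  by computability.
Qed.

Lemma computable_wreath_word (T : countType)
    (f : T -> wordB * seq (wordA * wordB)) :
  computable f -> computable (fun x => wreath_word (f x)).
Proof.
move=> cf; rewrite /wreath_word; computability => //.
- by apply: computable_relabel; computability.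
- by apply: computable_word_inv; apply: computable_relabel; computability.
- by apply: computable_relabel; computability.
- by apply: computable_relabel; computability.
Qed.

End WordComputable.

Ltac word_computability :=
  repeat match goal with
  | |- @computable _ _ (fun x => word_inv (@?f x)) =>
      apply: computable_word_inv
  | |- @computable _ _ (fun x => parts (@?f x)) => apply: computable_parts
  | |- @computable _ _ (fun x => wreath_word (@?f x)) =>
      apply: computable_wreath_word
  | |- _ => computability_step
  end.

(** * Solving the conjugacy problem in the wreath product *)

Section Matchings.

Context {T U : eqType}.

(** All assignments of entries of [Q] to the positions of [P]; covering all of [Q] is tested
    separately. *)
Definition matchings (P : seq T) (Q : seq U) : seq (seq (T * U)) :=
  foldr (fun x acc => flatten [seq [seq (x, y) :: z | z <- acc] | y <- Q])
    [:: [::]] P.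

Lemma matchingsP P Q z :
  reflect (unzip1 z = P /\ {subset unzip2 z <= Q}) (z \in matchings P Q).
Proof.
apply: (iffP idP) => [|[<- zQ]].
  elim: P z => [|x P IH] z /=; first by rewrite inE => /eqP->.
  case/flattenP=> _ /mapP[y yQ ->] /mapP[z' /IH[<- z'Q] ->]; split=> // u.
  by rewrite inE => /orP[/eqP->|/z'Q].
elim: z zQ => [|[x y] z IH] zQ; first exact: mem_head.
apply/flattenP; exists [seq (x, y) :: z | z <- matchings (unzip1 z) Q].
  by apply/mapP; exists y => //; apply: zQ; exact: mem_head.
by apply/map_f/IH => u uz; apply: zQ; rewrite inE uz orbT.
Qed.

End Matchings.

Lemma computable_matchings (X T U : countType) (P : X -> seq T) (Q : X -> seq
  U) :
  computable P -> computable Q -> computable (fun x => matchings (P x) (Q x)).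
Proof.
move=> cP cQ; rewrite /matchings; computability.
Qed.

(** * The conjugacy algorithm, from given decision procedures *)

Section ConjugacyAlgorithm.

Context {A B : groupType} {S : choiceType} (to : right_action B S) (s0 : S).
Context {p q : nat} (gA : 'I_p -> A) (gB : 'I_q -> B).

Local Notation evA := (word_eval gA).
Local Notation evB := (word_eval gB).
Local Notation gens := (wreath_gens to gA gB s0).
Local Notation evW := (word_eval gens).
Local Notation wordA := (word 'I_p).
Local Notation wordB := (word 'I_q).
Local Notation wordW := (word ('I_q + 'I_p)%type).
Local Notation point := (point to s0 gA gB).

Context (trivA : wordA -> bool) (trivB : wordB -> bool)
  (conjB : wordB * wordB -> bool) (mem_coset : wordB * wordB * wordB -> bool)
  (compat : wordB * wordB * (wordA * wordA) -> bool)
  (disjoint : wordB * seq (wordB * wordB) -> bool).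

Context (trivA_computable : computable trivA)
  (trivB_computable : computable trivB)
  (conjB_computable : computable conjB)
  (mem_coset_computable : computable mem_coset)
  (compat_computable : computable compat)
  (disjoint_computable : computable disjoint).

Context (trivAP : forall w, evA w = 1 <-> trivA w)
  (trivBP : forall w, evB w = 1 <-> trivB w)
  (conjBP : forall u v, (exists x, evB u ^ x = evB v) <-> conjB (u, v))
  (mem_cosetP : forall b t t',
    cyclic_orbit to (evB b) (to s0 (evB t)) (to s0 (evB t')) <->
    mem_coset (t, b, t'))
  (compatP : forall b t a a',
    compatible to (evB b) (to s0 (evB t)) (evA a) (evA a') <->
    compat (b, t, (a, a')))
  (disjointP : forall b ps,
    ~ (exists2 c, commute c (evB b) & {in ps, forall x,
      cyclic_orbit to (evB b) (to s0 (evB x.1 * c)) (to s0 (evB x.2))}) <->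
    disjoint (b, ps)).

Context (genA : forall x : A, exists w, evA w = x)
  (genB : forall x : B, exists w, evB w = x)
  (to_trans : transitive_action to).

(** The word problem of the wreath product. The empty word in the place of [b] turns [mem_coset]
    into a test for equality of points, and only listed points need checking. *)
Definition trivW (u : wordW) : bool :=
  trivB (parts u).1 &&
  all (fun x => trivA (flatten
    [seq y.1 | y <- (parts u).2 & mem_coset (y.2, [::], x.2)])) (parts u).2.

Lemma trivWP u : evW u = 1 <-> trivW u.
Proof.
have prodE t : base_prod (map point (parts u).2) (to s0 (evB t)) =
    evA (flatten [seq y.1 | y <- (parts u).2 & mem_coset (y.2, [::], t)]).
  rewrite base_prodE word_eval_flatten !big_map big_filter;
    apply: eq_bigl => y /=.
  apply/eqP/idP => [yt|/mem_cosetP];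
    last by rewrite word_eval_nil => /cyclic_orbit1.
  by apply/mem_cosetP; rewrite yt; exact: cyclic_orbit_refl.
rewrite word_eval_parts /trivW;
  split=> [[/trivBP -> F1]|/andP[/trivBP -> /allP F1]].
  by apply/allP => y _; apply/trivAP; rewrite -prodE F1 fsfunE.
congr pair; apply/fsfunP => s; rewrite [RHS]fsfunE.
have [[y yu <-]|noy] := pselect (exists2 y, y \in (parts u).2 & to s0 (evB y.2)
  = s).
  by rewrite prodE; apply/trivAP/F1.
apply: base_prod_notin => _ /mapP[y yu ->] /=.
by apply/eqP => ys; apply: noy; exists y.
Qed.

Lemma trivW_computable (T : countType) (f : T -> wordW) :
  computable f -> computable (fun x => trivW (f x)).
Proof.
move=> cf; have cp := computable_parts cf; rewrite /trivW; computability => //.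
by apply: (computable_comp cp); computability.
Qed.

Definition normal_word (b : wordB) (P : seq (wordA * wordB)) : bool :=
  pairwise (fun x y => ~~ mem_coset (x.2, b, y.2)) P &&
  all (fun x => ~~ trivA x.1) P.

Lemma normal_wordE b P : normal_word b P = normal to (evB b) (map point P).
Proof.
rewrite /normal /distinct_orbits pairwise_map all_map; congr (_ && _).
  apply: eq_pairwise => x y /=; rewrite asbool_neg; congr (~~ _).
  by apply/idP/asboolP => /mem_cosetP.
apply: eq_all => x /=; congr (~~ _).
by apply/idP/eqP => /trivAP.
Qed.

Lemma normal_word_computable (T : countType) (f : T -> wordB)
    (g : T -> seq (wordA * wordB)) :
  computable f -> computable g -> computable (fun x => normal_word (f x) (g x)).
Proof.
by move=> cf cg; rewrite /normal_word; computability.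
Qed.

Definition conj_normal (b : wordB) (P Q : seq (wordA * wordB)) : bool :=
  has (fun z => [&& all (fun y => y \in unzip2 z) Q,
    all (fun x => compat (b, x.1.2, (x.1.1, x.2.1))) z &
    ~~ disjoint (b, [seq (x.1.2, x.2.2) | x <- z])]) (matchings P Q).

(** For each matching, compatibility is independent of [c], which commutes with [b]. The existence
    of [c] then involves orbit conditions only, and these are an instance of (iv). *)
Lemma conj_normalP b P Q : normal_word b P -> normal_word b Q ->
  (exists z, evW (wreath_word (b, P)) ^ z = evW (wreath_word (b, Q))) <->
  conj_normal b P Q.
Proof.
rewrite !normal_wordE !word_eval_wreath => nP nQ.
rewrite wreath_conj_normal //; split=> [[c [z [cb zP zQ lz]]]|].
  apply/hasP; exists z; first by apply/matchingsP; split=> // y; rewrite zQ.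
  apply/and3P; split.
  - by apply/allP => y; rewrite zQ.
  - apply/allP => x xz; apply/compatP;
    by have [_ /(compatible_act to _ _ _ cb)] := lz x xz.
  - apply/negP => /disjointP; apply; exists c => // _ /mapP[x xz ->] /=.
    by rewrite ractM; exact: (lz _ xz).1.
case/hasP=> z /matchingsP[zP zQ] /and3P[/allP Qz /allP compz /negP ndis].
have [c cb cz] : exists2 c, commute c (evB b) & {in [seq (x.1.2, x.2.2) | x <-
  z],
    forall x, cyclic_orbit to (evB b) (to s0 (evB x.1 * c)) (to s0 (evB x.2))}.
  by apply: contrapT => no; apply/ndis/disjointP.
exists c, z; split=> // [y|x xz]; first by apply/idP/idP => [/zQ|/Qz].
split; first by rewrite -ractM; apply: (cz (x.1.2, x.2.2)); exact: map_f.
exact/(compatible_act to _ _ _ cb)/compatP/compz.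
Qed.

(* For [(u, v)] with conjugate [B]-parts, [((x, y), (P, Q))] certifies that
   [u ^ x] and [v ^ y] are the concentrated elements [(b, P)] and [(b, Q)] over
   the [B]-part [b] of [u]. *)
Definition certificate : countType :=
  ((wordW * wordW) * (seq (wordA * wordB) * seq (wordA * wordB)))%type.

(** Any certificate is accepted when the [B]-parts are not conjugate, so the search ends on every
    input. *)
Definition valid (t : wordW * wordW * certificate) : bool :=
  ~~ conjB ((parts t.1.1).1, (parts t.1.2).1) ||
  [&& trivW (word_inv t.2.1.1 ++ t.1.1 ++ t.2.1.1 ++
        word_inv (wreath_word ((parts t.1.1).1, t.2.2.1))),
      trivW (word_inv t.2.1.2 ++ t.1.2 ++ t.2.1.2 ++
        word_inv (wreath_word ((parts t.1.1).1, t.2.2.2))),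
      normal_word (parts t.1.1).1 t.2.2.1 & normal_word (parts t.1.1).1
        t.2.2.2].

Lemma trivW_conjP u x w :
  trivW (word_inv x ++ u ++ x ++ word_inv w) <-> evW u ^ evW x = evW w.
Proof.
rewrite -trivWP !word_eval_cat !word_eval_inv !mulgA conjgE mulgA.
by split=> [/divg1_eq|->]; rewrite ?mulgV.
Qed.

Lemma valid_exists x : exists c, valid (x, c).
Proof.
case: x => u v; have [bc|nbc] := boolP (conjB ((parts u).1, (parts v).1));
  last first.
  by exists (([::], [::]), ([::], [::])); rewrite /valid /= nbc.
have [c cb] := (conjBP _ _).2 bc.
pose b := (parts u).1.
(* First [c'] brings the [B]-part to [b], then the base function is concentrated. It is used with 1
   for [u] and with [c^-1] for [v]. *)
have ex w c' : evB (parts w).1 * c' = c' * evB b ->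
    exists x P, evW w ^ evW x = evW (wreath_word (b, P)) /\ normal_word b P.
  move=> wc; pose F := base_act to (base_prod (map point (parts w).2)) c'.
  have [P' nP' FP'] := normal_form to (evB b) F.
  have [P PE] := point_surj s0 genA genB to_trans P'.
  have [|z zE] := (@wreath_conjP _ _ _ _ (evW w) (evW (wreath_word (b, P)))).2.
    by exists c'; rewrite word_eval_wreath word_eval_parts //= PE.
  have [x xE] := wreath_word_surj s0 genA genB to_trans z.
  by exists x, P; rewrite xE zE normal_wordE PE.
have [|x [P [xP nP]]] := ex u 1; first by rewrite mulg1 mul1g.
have [|y [Q [yQ nQ]]] := ex v c^-1.
  by rewrite -cb conjgE -/b !mulgA mulgK.
exists ((x, y), (P, Q)); rewrite /valid /=; apply/orP; right.
by apply/and4P; split=> //; exact/trivW_conjP.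
Qed.

Lemma valid_computable : computable valid.
Proof.
rewrite /valid; word_computability.
- by apply: trivW_computable; word_computability.
- by apply: trivW_computable; word_computability.
- by apply: normal_word_computable; word_computability.
- by apply: normal_word_computable; word_computability.
Qed.

(** An unbounded search for a valid certificate replaces [u] and [v] by concentrated conjugates.
    Conjugacy of the [B]-parts is tested again, as the certificate is arbitrary when it fails. *)
Lemma conjugacy_algorithm : conjugacy_problem gens.
Proof.
have eW : effective wordW := @effective_word ('I_q + 'I_p)%type.
have eA : effective wordA := @effective_word 'I_p.
have eB : effective wordB := @effective_word 'I_q.
apply: (@algorithmic_search _ certificate valid (fun t =>
  conjB ((parts t.1.1).1, (parts t.1.2).1) &&
  conj_normal (parts t.1.1).1 t.2.2.1 t.2.2.2)).
- exact: (effective_pair eW eW).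
- apply: (effective_pair (effective_pair eW eW)).
  have eL := effective_seq (effective_pair eA eB).
  exact: (effective_pair eL eL).
- exact: algorithmic_computable valid_computable.
- apply: algorithmic_computable; rewrite /conj_normal /unzip2;
  word_computability.
  by apply: computable_matchings; word_computability.
- exact: valid_exists.
move=> [u v] [[x y] [P Q]]; rewrite /valid /=.
case: (boolP (conjB _)) => [_ /and4P[/trivW_conjP xP /trivW_conjP yQ nP nQ]|nb
  _] /=.
  rewrite -conj_normalP // -xP -yQ; split=> [[z zE]|[z zE]].
    exists ((evW x)^-1 * z * evW y).
    by rewrite conjgM conjgM conjgK zE.
  exists (evW x * z * (evW y)^-1).
  by rewrite !conjgM zE conjgK.
split=> // -[z zE]; case/negP: nb; apply/conjBP; exists z.1.
by move: (congr1 fst zE); rewrite !word_eval_parts.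
Qed.

End ConjugacyAlgorithm.

Lemma algorithmic_reduction (T U : countType) (P : set T) (Q : set U)
    (f : T -> U) :
  computable f -> (forall x, P x <-> Q (f x)) -> algorithmic Q -> algorithmic P.
Proof.
move=> cf PQ [d cd dP]; exists (fun x => d (f x)); first exact: computable_comp.
by move=> x; rewrite PQ.
Qed.

Lemma word_problem (I : countType) (G : groupType) (g : I -> G) :
  conjugacy_problem g -> algorithmic (fun w => word_eval g w = 1).
Proof.
apply: (@algorithmic_reduction _ _ _ _ (fun w => (w, [::]))).
  by computability.
move=> w; rewrite /= word_eval_nil; split=> [->|[x /eqP]]; last first.
  by rewrite conjg_eq1 => /eqP.
by exists 1; rewrite conj1g.
Qed.

(** * Conditions (i)-(iv) suffice *)

Section Sufficiency.

Context {A B : groupType} {S : choiceType} (to : right_action B S) (s0 : S).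
Context {p q : nat} (gA : 'I_p -> A) (gB : 'I_q -> B).
Context (genA : forall x : A, exists w, word_eval gA w = x)
  (genB : forall x : B, exists w, word_eval gB w = x)
  (to_trans : transitive_action to).

(** Condition (ii) enters here: in an abelian group conjugate values are equal, so compatibility is
    equality; otherwise finiteness of the orbit is decided by the orbit order algorithm. *)
Lemma compatible_algorithmic :
  conjugacy_problem gA -> abelian_group A \/ orbit_order_problem to s0 gB ->
  algorithmic (fun x : word 'I_q * word 'I_q * (word 'I_p * word 'I_p) =>
    compatible to (word_eval gB x.1.1) (to s0 (word_eval gB x.1.2))
      (word_eval gA x.2.1) (word_eval gA x.2.2)).
Proof.
move=> cpA; have [triv ctriv trivP] := word_problem cpA.
have eqP u v : word_eval gA u = word_eval gA v <-> triv (u ++ word_inv v).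
  rewrite -trivP word_eval_cat word_eval_inv.
  by split=> [->|/divg1_eq//]; rewrite mulgV.
case=> [abA|[orb corb orbP]].
  exists (fun x => triv (x.2.1 ++ word_inv x.2.2)); first by word_computability.
  move=> x; rewrite -eqP; split=> [[//|[_ [y <-]]]|]; last by left.
  by rewrite conjgE (abA _ y) mulKg.
case: cpA => conj cconj conjP.
exists (fun x => triv (x.2.1 ++ word_inv x.2.2) || orb x.1 && conj x.2).
  by word_computability.
move=> [[b t] [a a']] /=; split=> [[/eqP-> //|[fO aa']]|/orP[/eqP|]].
- by apply/orP; right; apply/andP; split; [apply/orbP | apply/conjP].
- by left.
- by case/andP=> /orbP fO /conjP aa'; right.
Qed.

Lemma conjugacy_sufficient :
  [/\ conjugacy_problem gA /\ conjugacy_problem gB,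
      abelian_group A \/ orbit_order_problem to s0 gB,
      membership_problem to s0 gB &
      intersection_problem to s0 gB] ->
  conjugacy_problem (wreath_gens to gA gB s0).
Proof.
case=> -[cpA cpB] ab_oo [mem_coset c_mem memP] [disjoint c_disj disjP].
have [trivA c_trivA trivAP] := word_problem cpA.
have [trivB c_trivB trivBP] := word_problem cpB.
have [compat c_compat compatP] := compatible_algorithmic cpA ab_oo.
case: cpB => conjB c_conjB conjBP.
apply: (@conjugacy_algorithm _ _ _ to s0 _ _ gA gB trivA trivB conjB mem_coset
  compat disjoint) => //.
- by move=> u v; exact: (conjBP (u, v)).
- by move=> b t t'; rewrite -(memP (t, b, t')) stab_cyclicP.
- by move=> b t a a'; exact: (compatP (b, t, (a, a'))).
- by move=> b ps; rewrite -(disjP (b, ps)) intersectionP.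
Qed.

End Sufficiency.

(** * Conditions (i)-(iv) are necessary *)

Section Necessity.

Context {A B : groupType} {S : choiceType} (to : right_action B S) (s0 : S).
Context {p q : nat} (gA : 'I_p -> A) (gB : 'I_q -> B).
Context (genA : forall x : A, exists w, word_eval gA w = x)
  (genB : forall x : B, exists w, word_eval gB w = x)
  (to_trans : transitive_action to).

Local Notation evA := (word_eval gA).
Local Notation evB := (word_eval gB).
Local Notation gens := (wreath_gens to gA gB s0).
Local Notation wr b f := ((b, f) : wreath A to).
Local Notation base1 := ([fsfun of _ => 1] : {fsfun S -> A with 1}).
Local Notation wordA := (word 'I_p).
Local Notation wordB := (word 'I_q).
Local Notation point := (point to s0 gA gB).

Context (cpW : conjugacy_problem gens).

Lemma conjugacy_problemB : conjugacy_problem gB.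
Proof.
apply: (@algorithmic_reduction _ _ _ _
  (fun x => (wordWB x.1, wordWB x.2)) _ _ cpW).
  by computability; apply: computable_relabel; computability.
move=> [u v] /=; rewrite !word_evalWB.
split=> [[x xE]|[z /(congr1 fst) zE]]; last by exists z.1.
apply/wreath_conjP; exists x; first by rewrite /= -xE -conjgC.
by rewrite /= base_1act; exact: base_conj_refl.
Qed.

(** Elements of [A] are placed at [s0] over the trivial [B]-part, where conjugacy of base functions
    is pointwise. *)
Lemma conjugacy_problemA : conjugacy_problem gA.
Proof.
apply: (@algorithmic_reduction _ _ _ _
  (fun x => (wordWA x.1, wordWA x.2)) _ _ cpW).
  by computability; apply: computable_relabel; computability.
move=> [u v] /=; rewrite !word_evalWA wreath_conjP /=.
split=> [[x xE]|[c _ [g gP]]].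
  exists 1 => //; exists (base_delta x s0) => s.
  rewrite invg1 ract1 base_act1 !base_deltaE.
  by case: eqP => _; rewrite -?xE ?conjgE ?invg1 ?mul1g ?mulg1 // mulgA.
have {}gP s : base_delta (evA v) s0 s = base_delta (evA u) (to s0 c) s ^ g s.
  by rewrite gP invg1 ract1 base_act_delta conjgE mulgA.
have := gP s0; rewrite !base_deltaE eqxx; case: eqP => [_ ->|s0c].
  by exists (g s0).
(* If [c] moves [s0], comparing values at [s0] and at its image shows that both elements are
   trivial. *)
rewrite conj1g => v1; have := gP (to s0 c); rewrite !base_deltaE eqxx.
by case: eqP => [/esym//|_] /esym/eqP; rewrite conjg_eq1 => /eqP->; exists 1;
  rewrite conj1g.
Qed.

(** The assumed algorithm in the form used to test (ii)-(iv): it compares computable lists of values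
    over the same [b]. *)
Lemma conj_wreath_words (T : countType) (b : T -> wordB)
    (P Q : T -> seq (wordA * wordB)) :
  computable b -> computable P -> computable Q ->
  algorithmic (fun x => exists z,
    wr (evB (b x)) (base_prod (map point (P x))) ^ z =
    wr (evB (b x)) (base_prod (map point (Q x)))).
Proof.
move=> cb cP cQ.
apply: (@algorithmic_reduction _ _ _ _
  (fun x => (wreath_word (b x, P x), wreath_word (b x, Q x))) _ _ cpW).
  by word_computability.
by move=> x; rewrite /= !word_eval_wreath.
Qed.

Lemma membership_necessary : nontrivial A -> membership_problem to s0 gB.
Proof.
case=> a0 a0N; have [a aE] := genA a0; rewrite -{}aE in a0N.
have alg := @conj_wreath_words (wordB * wordB * wordB)%type (fun x => x.1.2)
  (fun x => [:: (a, x.1.1); (word_inv a, x.2)]) (fun=> [::])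
  ltac:(computability) ltac:(computability) ltac:(computability).
apply: (algorithmic_reduction (computable_id _) _ alg).
move=> [[c b] w] /=; rewrite stab_cyclicP.
have [cw|ncw] := pselect (cyclic_orbit to (evB b) (to s0 (evB c)) (to s0 (evB
  w))).
  split=> // _; apply/wreath_conjP; exists 1; first by rewrite /= mulg1 mul1g.
  rewrite /= base_act1 /point /= word_eval_inv.
  exact: (base_conj_cancel (evA a) cw).
split=> // zE.
(* In different orbits the two values form a normal list, and a nonempty list has no matching into
   the empty one. *)
have : exists z, wr (evB b) (base_prod (map point [:: (a, c);
  (word_inv a, w)])) ^ z =
  wr (evB b) (base_prod (map point [::])) by [].
rewrite wreath_conj_normal //; last first.
  rewrite /normal /distinct_orbits /= !andbT word_eval_inv a0N invg_eq1 a0N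
    !andbT.
  exact/asboolP.
by case=> d [z [_ zP zQ _]]; case: z zP zQ => // x z _ /(_ x.2);
  rewrite mem_head.
Qed.

Lemma orbit_order_necessary : abelian_group A \/ orbit_order_problem to s0 gB.
Proof.
have [abA|nabA] := pselect (abelian_group A); [by left | right].
have [x [y xy]] : exists x y : A, x ^ y <> x.
  apply: contrapT => no; apply: nabA => x y; rewrite /commute conjgC;
    congr (_ * _).
  by apply: contrapT => xy; apply: no; exists x, y.
have [a aE] := genA x; have [a' a'E] := genA (x ^ y).
have alg := @conj_wreath_words (wordB * wordB)%type (fun x => x.1)
  (fun x => [:: (a, x.2)]) (fun x => [:: (a', x.2)])
  ltac:(computability) ltac:(computability) ltac:(computability).
apply: (algorithmic_reduction (computable_id _) _ alg) => -[b t] /=.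
(* Both one-entry lists must be normal, so [x] and its conjugate have to be nontrivial. *)
have x1 : x != 1 by apply/eqP => x1; apply: xy; rewrite x1 conj1g.
rewrite (@wreath_conj_normal _ _ _ _ _ point _ [:: (a, t)] [:: (a', t)]);
  last first.
- by rewrite /normal /= andbT a'E conjg_eq1.
- by rewrite /normal /= andbT aE.
split=> [fO|[c [z [cb zP zQ lz]]]].
  exists 1, [:: ((a, t), (a', t))]; split=> // [|w];
    first exact/commute_sym/commute1.
  rewrite inE => /eqP->; split; rewrite /= ract1;
    first exact: cyclic_orbit_refl.
  by right; split=> //; exists y; rewrite aE a'E.
case: z zP zQ lz => [//|w z] [w1 _] zQ /(_ w (mem_head _ _)) [_].
have : w.2 \in unzip2 (w :: z) by exact: mem_head.
rewrite zQ inE w1 => /eqP-> /= /(compatible_act to _ _ _ cb) [|[//]].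
by rewrite aE a'E => /esym.
Qed.

(** Finitely many elements meet only finitely many classes, so a new label is available after any
    finite number of choices. *)
Lemma fresh_conjugacy_class (X : seq A) : infinite_set (conjugacy_classes A) ->
  exists a, {in X, forall x y, a ^ y <> x}.
Proof.
move=> infA; apply: contrapT => no; apply: infA.
apply: (@sub_finite_set _ _ [set conjugacy_class x | x in [set` X]]%classic);
  last exact/finite_image/finite_seq.
move=> _ [a _ <-].
have [x xX [y xE]] : exists2 x, x \in X & exists y, a ^ y = x.
  by apply: contrapT => nox; apply: no; exists a => x xX y axy; apply: nox;
    exists x => //; exists y.
exists x => //; apply/seteqP; split=> _ [z _ <-].
  by exists (y * z) => //; rewrite conjgM xE.
by exists (y^-1 * z) => //; rewrite conjgM -xE conjgK.
Qed.

Lemma intersection_necessary : nontrivial A -> infinite_set (conjugacy_classes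
  A) ->
  intersection_problem to s0 gB.
Proof.
move=> ntA infA.
have [dm c_dm dmP] := membership_necessary ntA.
have [triv c_triv trivP] := word_problem conjugacy_problemA.
have [dc c_dc dcP] := conjugacy_problemA.
pose data : countType := (wordB * seq (wordB * wordB))%type.
pose labels : countType := seq (wordA * (wordB * wordB)).
have orbP b t t' :
    cyclic_orbit to (evB b) (to s0 (evB t)) (to s0 (evB t')) <-> dm (t, b, t').
  by rewrite -(dmP (t, b, t')) stab_cyclicP.
(* Since [c] commutes with [b], it can exist only if [alpha_i], [alpha_j] lie in
   the same orbit exactly when [gamma_i], [gamma_j] do. The labels then attach
   values of [A] to one pair for each orbit of the [alpha_i]. *)
pose consistent (x : data) := all (fun y => all (fun y' =>
  dm (y.1, x.1, y'.1) == dm (y.2, x.1, y'.2)) x.2) x.2.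
have c_consistent : computable consistent by rewrite /consistent; computability.
(* Inconsistent data accept any labels, so the search ends. Otherwise the labelled pairs represent
   every orbit of an [alpha_i] exactly once, with nontrivial and pairwise non-conjugate values. *)
pose valid (t : data * labels) := ~~ consistent t.1 ||
  [&& all (fun k => k.2 \in t.1.2) t.2,
      all (fun y => has (fun k => dm (k.2.1, t.1.1, y.1)) t.2) t.1.2,
      pairwise (fun k k' => ~~ dm (k.2.1, t.1.1, k'.2.1) && ~~ dc (k.1, k'.1))
        t.2 &
      all (fun k => ~~ triv k.1) t.2].
have c_valid : computable valid by rewrite /valid; computability.
pose src (K : labels) := [seq (k.1, k.2.1) | k <- K].
pose tgt (K : labels) := [seq (k.1, k.2.2) | k <- K].
have [dW c_dW dWP] := @conj_wreath_words (data * labels)%type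
  (fun t => t.1.1) (fun t => src t.2) (fun t => tgt t.2)
  ltac:(computability) ltac:(rewrite /src; computability)
  ltac:(rewrite /tgt; computability).
have eB : effective wordB := @effective_word 'I_q.
have eA : effective wordA := @effective_word 'I_p.
have eBB := effective_pair eB eB.
apply: (@algorithmic_search data labels valid
  (fun t => ~~ (consistent t.1 && dW t))).
- exact: (effective_pair eB (effective_seq eBB)).
- exact: (effective_seq (effective_pair eA eBB)).
- exact: algorithmic_computable c_valid.
- by apply: algorithmic_computable; computability.
- move=> [b ps]; have [cons|ncons] := boolP (consistent (b, ps)); last first.
    by exists [::]; rewrite /valid ncons.
  rewrite /valid /= cons /=; elim: ps {cons} => [|y ps [K]];
    first by exists [::].
  case/and4P=> /allP Kps /allP psK pK tK.
  have psK' k : k \in K -> k.2 \in y :: ps by move=> /Kps kps;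
    rewrite inE kps orbT.
  have [hy|nhy] := boolP (has (fun k => dm (k.2.1, b, y.1)) K).
    exists K; rewrite /= hy pK tK /= andbT; apply/andP.
    by split; apply/allP.
  (* Including 1 among the elements to avoid makes the new label nontrivial. *)
  have [a aP] := fresh_conjugacy_class (1 :: [seq evA k.1 | k <- K]) infA.
  have [w wE] := genA a.
  have nw : ~~ triv w.
    apply/negP => /trivP wa; apply: (aP 1 (mem_head _ _) 1).
    by rewrite -wE wa conj1g.
  exists ((w, y) :: K); rewrite /= mem_head pK tK nw /= !andbT.
  apply/and3P; split; first by apply/allP.
    have -> /= : dm (y.1, b, y.1) by apply/orbP; exact: cyclic_orbit_refl.
    by apply/allP => z /psK ->; rewrite orbT.
  - apply/allP => k kK; apply/andP; split.
      apply: contra nhy => /orbP yk; apply/hasP; exists k => //.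
      exact/orbP/cyclic_orbit_sym.
    apply/negP => /dcP [z] /=; rewrite wE; apply: aP.
    by rewrite inE (map_f (fun k => evA k.1)) ?orbT.
move=> [b ps] K; rewrite intersectionP /valid /= => vK.
set E := exists2 c, _ & _;
  suff -> : E <-> consistent (b, ps) && dW ((b, ps), K).
  by split=> /negP.
have consE : E -> consistent (b, ps).
  case=> c cb cps; apply/allP => y yps; apply/allP => y' y'ps; apply/eqP.
  apply/idP/idP => /orbP yy'; apply/orbP.
    apply: cyclic_orbit_trans (cyclic_orbit_sym (cps y yps)) _.
    by apply: cyclic_orbit_trans (cps y' y'ps);
      rewrite !ractM cyclic_orbit_commute.
  apply/(cyclic_orbit_commute to _ _ cb); rewrite -!ractM.
  apply: cyclic_orbit_trans (cps y yps) _.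
  exact: cyclic_orbit_trans yy' (cyclic_orbit_sym (cps y' y'ps)).
have [/= cons|ncons] := boolP (consistent (b, ps)); last first.
  by split=> // /consE; rewrite (negPf ncons).
move: vK; rewrite cons /= => /and4P[/allP Kps /allP psK pK tK].
have consK k k' : k \in K -> k' \in K ->
    dm (k.2.1, b, k'.2.1) = dm (k.2.2, b, k'.2.2).
  move=> /Kps kps /Kps k'ps.
  by move/allP/(_ _ kps)/allP/(_ _ k'ps)/eqP: cons.
have nonzero (f : wordB * wordB -> wordB) :
    all (fun x => x.1 != 1) [seq point (k.1, f k.2) | k <- K].
  rewrite all_map; apply: sub_all tK => k /=; apply: contra => /eqP.
  by move/trivP.
have nP : normal to (evB b) (map point (src K)).
  rewrite /normal -map_comp nonzero andbT /distinct_orbits pairwise_map.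
  apply: sub_pairwise pK => k k' /= /andP[+ _]; apply: contraNT.
  by rewrite -asbool_neg => /asboolP /contrapT /orbP.
(* Consistency transfers distinctness of the orbits from the [alpha_i] to the [gamma_i]. *)
have nQ : normal to (evB b) (map point (tgt K)).
  rewrite /normal -map_comp nonzero andbT /distinct_orbits pairwise_map.
  apply: sub_in_pairwise (allss K) pK => k k' kK k'K /= /andP[+ _].
  rewrite consK //; apply: contraNT.
  by rewrite -asbool_neg => /asboolP /contrapT /orbP.
rewrite -dWP /= wreath_conj_normal //;
  split=> [[c cb cps]|[c [z [cb zP zQ lz]]]].
  exists c, [seq ((k.1, k.2.1), (k.1, k.2.2)) | k <- K]; split=> //.
  - by rewrite /unzip1 -map_comp.
  - by rewrite /unzip2 -map_comp.
  move=> _ /mapP[k /Kps kps ->]; split; last by left.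
  by rewrite /= -ractM; exact: cps.
(* An arbitrary pair [y] is reduced to the labelled pair [k] of its orbit; consistency puts the
   [gamma] of [y] in the orbit of that of [k]. *)
exists c => // y yps; have /hasP[k kK ky] := psK y yps.
have /orbP ky2 : dm (k.2.2, b, y.2).
  by have /allP/(_ _ (Kps _ kK))/allP/(_ _ yps)/eqP <- := cons.
have : (k.1, k.2.1) \in unzip1 z by rewrite zP;
  exact: (map_f (fun k => (k.1, k.2.1))).
case/mapP=> w wz wk; have : w.2 \in tgt K by rewrite -zQ; exact: map_f.
case/mapP=> l lK wl; have [] := lz w wz; rewrite -wk wl /= => kl comp.
(* Compatible labels are conjugate, whereas different entries of [K] have non-conjugate labels;
   hence [c] carries [k] to its own target. *)
have klE : k = l.
  have nconj m m' : m \in K -> m' \in K -> compatible to (evB b) (to (to s0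
    (evB m.2.1)) c)
    (evA m.1) (evA m'.1) -> dc (m.1, m'.1).
    move=> _ _ [mm'|[_ mm']]; last exact/dcP.
    by apply/dcP; exists 1; rewrite /= conjg1.
  have /or3P[/eqP//|/andP[_ /negP[]]|/andP[_ /negP[]]] := pairwise_mem pK kK lK.
    exact: nconj comp.
  apply/dcP; have /dcP [x /= xE] := nconj _ _ kK lK comp.
  by exists x^-1; rewrite /= -xE conjgK.
move/orbP: ky => /(cyclic_orbit_commute to _ _ cb); rewrite -!ractM => ky1.
apply: cyclic_orbit_trans (cyclic_orbit_sym ky1) _.
by apply: cyclic_orbit_trans ky2; rewrite ractM {2}klE.
Qed.

End Necessity.

Theorem theorem1p0p3 (A B : groupType) (p q : nat)
    (gA : 'I_p -> A) (gB : 'I_q -> B)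
    (S : choiceType) (to : right_action B S) (s0 : S)
    (A_nontrivial : nontrivial A) (B_nontrivial : nontrivial B)
    (A_presented : recursively_presented gA)
    (B_presented : recursively_presented gB)
    (A_classes : infinite_set (conjugacy_classes A))
    (to_transitive : transitive_action to) :
  conjugacy_problem (wreath_gens to gA gB s0) <->
  [/\ conjugacy_problem gA /\ conjugacy_problem gB,
      abelian_group A \/ orbit_order_problem to s0 gB,
      membership_problem to s0 gB &
      intersection_problem to s0 gB].
Proof.
have [_ _ [genA _]] := A_presented; have [_ _ [genB _]] := B_presented.
split=> [cpW|]; last exact: conjugacy_sufficient.
split.
- by split; [exact: conjugacy_problemA cpW | exact: conjugacy_problemB cpW].
- exact: orbit_order_necessary cpW.
- exact: membership_necessary cpW A_nontrivial.
- exact: intersection_necessary cpW A_nontrivial A_classes.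
Qed.
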